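(* Let $M$ be a smooth paracompact manifold, $P$ a bundle on $M$ with connection with curvature $F$, and let $\hat c_i(F),\hat c_j(F),\hat c_k(F)$ be Čech–Deligne cocycles, of degrees $i,j,k$, refining characteristic classes $c_i(P),c_j(P),c_k(P)$. Suppose given Čech–Deligne cochains $\hat\alpha_{(i+j-1)}$ and $\hat\beta_{(j+k-1)}$ such that $$\hat c_i(F)\cup\hat c_j(F)=D\hat\alpha_{(i+j-1)},\qquad \hat c_j(F)\cup\hat c_k(F)=D\hat\beta_{(j+k-1)} .$$ Then $$\hat\mu=\hat c_i(F)\cup\hat\beta_{(j+k-1)}+(-1)^{i-1}\hat\alpha_{(i+j-1)}\cup\hat c_k(F)$$ defines a differential cohomology class which is an element of the stacky Massey product $\langle\hat c_i(P),\hat c_j(P),\hat c_k(P)\rangle$ in $\hat H^{i+j+k-1}(M;\mathbb Z)$.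
   Context: The Deligne complex is $\mathbb{Z}^\infty_{\mathcal D}[p]=[\underline{\mathbb Z}\hookrightarrow\Omega^0\to\cdots\to\Omega^{p-1}]$, with $\underline{\mathbb Z}$ in chain degree $p$ and $\Omega^{p-1}$ in degree $0$. $C^\bullet(p)$ is the total complex of the Čech–Deligne double complex of $\mathbb{Z}^\infty_{\mathcal D}[p]$ for a good open cover of $M$, graded so that $H^p(C^\bullet(p))=\hat H^p(M;\mathbb Z)$; its differential is $D$ (the combination $d+(-1)^k\delta$ of de Rham and Čech differentials). A degree $p$ differential cohomology class is represented by a cocycle in $C^p(p)$. The Deligne–Beilinson product $\mathbb{Z}^\infty_{\mathcal D}[p]\otimes\mathbb{Z}^\infty_{\mathcal D}[q]\to\mathbb{Z}^\infty_{\mathcal D}[p+q]$ is $\alpha\cup\beta=\alpha\beta$ if $\deg\alpha=p$, $\alpha\wedge d\beta$ if $\deg\beta=0$ and $\deg\alpha<p$, and $0$ otherwise; it induces an associative product $C^r(p)\otimes C^s(q)\to C^{r+s}(p+q)$ satisfying $D(x\cup y)=Dx\cup y+(-1)^{r}x\cup Dy$ for $x$ of degree $r$. Here $\hat\alpha_{(i+j-1)}\in C^{i+j-1}(i+j)$ and $\hat\beta_{(j+k-1)}\in C^{j+k-1}(j+k)$. The stacky triple Massey product of classes $\hat x,\hat y,\hat z$ of degrees $i,j,k$ with $\hat x\cup\hat y=0=\hat y\cup\hat z$ in differential cohomology is (up to the overall sign convention) the set of classes of the cocycles $\hat x\cup\hat b+(-1)^{i-1}\hat a\cup\hat z$, where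 $D\hat a=\hat x\cup\hat y$ and $D\hat b=\hat y\cup\hat z$. Such cocycles lie in $C^{i+j+k-1}(i+j+k)$, whose cohomology in that degree is $H^{i+j+k-2}(M;U(1))$, and this group is regarded as the subgroup of flat classes in $\hat H^{i+j+k-1}(M;\mathbb Z)$ via the inclusion of flat classes. *)

(* Defs.v *)
From HB Require Import structures.
From mathcomp Require Import all_boot all_order all_algebra all_fingroup.
From mathcomp Require Import all_classical all_reals all_analysis.
Import Order.TTheory GRing.Theory Num.Theory.
Import numFieldNormedType.Exports.

Set Implicit Arguments.
Unset Strict Implicit.
Unset Printing Implicit Defensive.

Local Open Scope classical_set_scope.
Local Open Scope ring_scope.

(* C^oo on an open set A: all iterated directional derivatives exist and are
   differentiable at every point of A. *)
Definition smooth_on {R : realType} {V W : normedModType R} (A : set V)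
    (f : V -> W) : Prop :=
  forall (vs : seq V) (x : V), A x ->
    differentiable (foldr (fun v g => 'D_v g) f vs) x.

Record charted (R : realType) := Charted {
  cdim : nat;
  cspace :> topologicalType;
  cix : Type;
  cdom : cix -> set cspace;
  cmap : cix -> cspace -> 'rV[R]_cdim;
  cinv : cix -> 'rV[R]_cdim -> cspace }.

(* Charts are total functions; [cmap a] and [cinv a] are only meaningful on
   [cdom a] and [creg M a setT] respectively. [creg M a U] is the image of U in
   the chart a. *)
Definition creg {R : realType} (M : charted R) (a : cix M) (U : set M) :
    set 'rV[R]_(cdim M) :=
  cmap a @` (cdom a `&` U).

Definition ctrans {R : realType} (M : charted R) (a b : cix M) :
    'rV[R]_(cdim M) -> 'rV[R]_(cdim M) :=
  fun x => cmap b (cinv a x).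

Definition locally_finite {T : topologicalType} (D : set (set T)) : Prop :=
  forall p : T, exists2 N, nbhs p N &
    finite_set [set B | D B /\ B `&` N !=set0].

Definition paracompact (T : topologicalType) : Prop :=
  forall C : set (set T), C `<=` open -> \bigcup_(A in C) A = setT ->
  exists D : set (set T), [/\ D `<=` open, \bigcup_(B in D) B = setT,
    (forall B, D B -> exists2 A, C A & B `<=` A) & locally_finite D].

Record smooth_manifold {R : realType} (M : charted R) : Prop := {
  sm_hausdorff : hausdorff_space M;
  sm_paracompact : paracompact M;
  sm_cover : forall p : M, exists a : cix M, cdom a p;
  sm_dom_open : forall a : cix M, open (cdom a);
  sm_img_open : forall a : cix M, open (creg a setT);
  sm_map_cont : forall a : cix M, {within cdom a, continuous (cmap a)};
  sm_inv_cont : forall a : cix M, {within creg a setT, continuous (cinv a)};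
  sm_mapK : forall (a : cix M) (p : M), cdom a p -> cinv a (cmap a p) = p;
  sm_trans : forall a b : cix M, smooth_on (creg a (cdom b)) (ctrans a b) }.

Record manifold (R : realType) := Manifold {
  mcharted :> charted R;
  manifoldP : smooth_manifold mcharted }.

Definition prod_charted {R : realType} (M N : charted R) : charted R :=
  @Charted R (cdim M + cdim N) (M * N)%type (cix M * cix N)%type
    (fun ab => cdom ab.1 `*` cdom ab.2)
    (fun ab p => row_mx (cmap ab.1 p.1) (cmap ab.2 p.2))
    (fun ab x => (cinv ab.1 (lsubmx x), cinv ab.2 (rsubmx x))).

(* Smoothness on an open set W. *)
Definition smooth_map {R : realType} (M N : charted R) (W : set M)
    (f : M -> N) : Prop :=
  (forall p, W p -> {for p, continuous f}) /\
  forall (a : cix M) (b : cix N),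
    smooth_on (creg a (W `&` f @^-1` cdom b))
      (fun x => cmap b (f (cinv a x))).

(* A form is given by its local representatives: [w a x vs] is the value, in
   the chart a, at the point of coordinates x, on the list vs of tangent
   vectors (in coordinates). For a k-form only lists of size k matter. *)
Definition rform {R : realType} (M : charted R) (V : zmodType) : Type :=
  cix M -> 'rV[R]_(cdim M) -> seq 'rV[R]_(cdim M) -> V.
HB.instance Definition _ (R : realType) (M : charted R) (V : zmodType) :=
  GRing.Zmodule.on (@rform R M V).

Definition multilinear {R : realType} {V W : lmodType R} (k : nat)
    (f : seq V -> W) : Prop :=
  forall (c : R) (u v : V) (s t : seq V), (size s + size t).+1 = k ->
    f (s ++ (c *: u + v) :: t) = c *: f (s ++ u :: t) + f (s ++ v :: t).

Definition alternating {R : realType} {V W : lmodType R} (k : nat)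
    (f : seq V -> W) : Prop :=
  forall (u : V) (s t r : seq V), (size s + size t + size r).+2 = k ->
    f (s ++ u :: t ++ u :: r) = 0.

Section Forms.
Context {R : realType} {M : charted R}.
Local Notation E := 'rV[R]_(cdim M).

(* V-valued differential k-forms on the open set U. *)
Record is_form {V : normedModType R} (k : nat) (U : set M) (w : rform M V) :
    Prop := {
  form_smooth : forall (a : cix M) (vs : seq E), size vs = k ->
    smooth_on (creg a U) (fun x => w a x vs);
  form_multilinear : forall (a : cix M) (x : E), creg a U x ->
    multilinear k (w a x);
  form_alternating : forall (a : cix M) (x : E), creg a U x ->
    alternating k (w a x);
  form_compat : forall (a b : cix M) (x : E) (vs : seq E),
    creg a (U `&` cdom b) x -> size vs = k ->
    w a x vs = w b (ctrans a b x) [seq 'D_v (ctrans a b) x | v <- vs] }.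

Definition form_eq {V : zmodType} (k : nat) (U : set M) (w w' : rform M V) :
    Prop :=
  forall (a : cix M) (x : E) (vs : seq E), creg a U x -> size vs = k ->
    w a x vs = w' a x vs.

Definition del {T : Type} (l : nat) (s : seq T) : seq T :=
  take l s ++ drop l.+1 s.

(* Exterior derivative, on constant vector fields in a chart. *)
Definition dR {V : normedModType R} (w : rform M V) : rform M V :=
  fun a x vs => \sum_(l < size vs)
    (-1) ^+ l *: 'D_(nth 0 vs l) (fun y => w a y (del l vs)) x.

(* Number of inversions of the shuffle moving the entries selected by the mask
   m before the other ones. *)
Definition shuffle_inv (m : bitseq) : nat :=
  \sum_(l < size m | nth false m l) count negb (take l m).

(* Wedge product of a p-form and a form, as the signed sum over shuffles. *)
Definition wedge (p : nat) (w w' : rform M R) : rform M R :=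
  fun a x vs => \sum_(m : (size vs).-tuple bool | count id m == p)
    (-1) ^+ shuffle_inv m * w a x (mask m vs) * w' a x (mask (map negb m) vs).

Definition int_form (n : M -> int) : rform M R :=
  fun a x _ => (n (cinv a x))%:~R.

Definition scale_form (n : M -> int) (w : rform M R) : rform M R :=
  fun a x vs => (n (cinv a x))%:~R * w a x vs.

End Forms.

(* Local sections of ZZ_D[p] = [ZZ -> Omega^0 -> ... -> Omega^(p-1)]. We index
   by the cohomological degree e = p - (chain degree): e = 0 is the constant
   sheaf ZZ and 1 <= e <= p is Omega^(e-1). A section of degree e is encoded by
   a pair, of which only the first component is relevant if e = 0, only the
   second one if 1 <= e <= p, and none if p < e. *)
Definition dsec {R : realType} (M : charted R) : Type :=
  ((M -> int) * rform M R)%type.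
HB.instance Definition _ (R : realType) (M : charted R) :=
  GRing.Zmodule.on (@dsec R M).

Definition locally_constant {T : topologicalType} {A : Type} (U : set T)
    (n : T -> A) : Prop :=
  forall x, U x -> \forall y \near x, n y = n x.

Section Deligne.
Context {R : realType} {M : charted R}.

Definition is_dsec (p e : nat) (U : set M) (s : dsec M) : Prop :=
  if e == 0%N then locally_constant U s.1
  else (e <= p)%N -> is_form e.-1 U s.2.

Definition dsec_eq (p e : nat) (U : set M) (s t : dsec M) : Prop :=
  if e == 0%N then forall x, U x -> s.1 x = t.1 x
  else (e <= p)%N -> form_eq e.-1 U s.2 t.2.

Definition under_form (e : nat) (s : dsec M) : rform M R :=
  if e == 0%N then int_form s.1 else s.2.

(* The differential of ZZ_D[p] from degree e to degree e+1. *)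
Definition ddel (p e : nat) (s : dsec M) : dsec M :=
  if (p <= e)%N then 0
  else if e == 0%N then (0, int_form s.1) else (0, dR s.2).

(* The Deligne-Beilinson product of s in degree e1 of ZZ_D[p] and t in degree
   e2 of ZZ_D[q]. In chain degrees, deg s = p reads e1 = 0 and deg t = 0 reads
   e2 = q. *)
Definition db_prod (p q e1 e2 : nat) (s t : dsec M) : dsec M :=
  if (p < e1)%N || (q < e2)%N then 0
  else if e1 == 0%N then
    (if e2 == 0%N then (fun x => s.1 x * t.1 x, 0) else (0, scale_form s.1 t.2))
  else if e2 == q then (0, wedge e1.-1 s.2 (dR (under_form e2 t)))
  else 0.

End Deligne.

Definition contractible {R : realType} {T : topologicalType} (U : set T) :
    Prop :=
  exists (c : T) (H : R * T -> T), [/\ U c,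
    {within `[0, 1]%classic `*` U, continuous H},
    (forall t x, t \in `[0, 1] -> U x -> U (H (t, x))),
    (forall x, U x -> H (0, x) = x) &
    (forall x, U x -> H (1, x) = c)].

Definition inter {T I : Type} (U : I -> set T) (s : seq I) : set T :=
  \big[setI/setT]_(a <- s) U a.

Record good_cover {R : realType} (M : charted R) (I : Type)
    (U : I -> set M) : Prop := {
  gc_open : forall a, open (U a);
  gc_cover : forall x, exists a, U a x;
  gc_contractible : forall s : seq I, (0 < size s)%N -> inter U s !=set0 ->
    @contractible R M (inter U s) }.

(* Cochains in C^r(p). A Cech c-simplex is a list of c+1 indices; on it the
   cochain has a component of Deligne degree e = r - c. Simplices of
   dimension > r and the empty list are irrelevant. *)
Definition cochain {R : realType} (M : charted R) (I : Type) (r p : nat) :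
    Type :=
  seq I -> dsec M.
HB.instance Definition _ (R : realType) (M : charted R) (I : Type)
    (r p : nat) :=
  GRing.Zmodule.on (@cochain R M I r p).

Section CechDeligne.
Context {R : realType} {M : charted R} {I : Type} (U : I -> set M).

Definition is_cochain {r p : nat} (x : cochain M I r p) : Prop :=
  forall s : seq I, (0 < size s <= r.+1)%N ->
    is_dsec p (r.+1 - size s) (inter U s) (x s).

Definition cochain_eq {r p : nat} (x y : cochain M I r p) : Prop :=
  forall s : seq I, (0 < size s <= r.+1)%N ->
    dsec_eq p (r.+1 - size s) (inter U s) (x s) (y s).

Definition cech_delta {r p : nat} (x : cochain M I r p) (s : seq I) : dsec M :=
  \sum_(l < size s) x (del l s) *~ (-1) ^+ l.

(* D = d + (-1)^k delta, with k the degree in the Deligne complex (0 on ZZ,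
   m + 1 on Omega^m). On a simplex of dimension c the result has Deligne degree
   e = r + 1 - c. *)
Definition D {r p : nat} (x : cochain M I r p) : cochain M I r.+1 p :=
  fun s => let e := (r.+2 - size s)%N in
    (if e == 0%N then 0 else ddel p e.-1 (x s)) +
    (if (size s <= 1)%N then 0 else cech_delta x s *~ (-1) ^+ e).

(* Product induced by the Deligne-Beilinson product, with the Koszul sign. *)
Definition cup {r1 p r2 q : nat} (x : cochain M I r1 p)
    (y : cochain M I r2 q) : cochain M I (r1 + r2) (p + q) :=
  fun s => \sum_(c1 < size s)
    let c2 := ((size s).-1 - c1)%N in
    if (c1 <= r1)%N && (c2 <= r2)%N then
      db_prod p q (r1 - c1) (r2 - c2) (x (take c1.+1 s)) (y (drop c1 s))
        *~ (-1) ^+ (c1 * (r2 - c2))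
    else 0.

Definition cocycle {r p : nat} (x : cochain M I r p) : Prop :=
  is_cochain x /\ cochain_eq (D x) 0.

Definition coboundary {r p : nat} (x : cochain M I r p) : Prop :=
  match r with
  | 0%N => cochain_eq x 0
  | r'.+1 => exists2 w : cochain M I r' p, is_cochain w & cochain_eq x (D w)
  end.

(* Cohomology classes are sets of cocycles. *)
Definition coh_class {r p : nat} (x : cochain M I r p) :
    set (cochain M I r p) :=
  [set y | cocycle y /\ coboundary (y - x : cochain M I r p)].

Definition cohomology (r p : nat) : set (set (cochain M I r p)) :=
  [set A | exists2 x, cocycle x & A = coh_class x].
Arguments cohomology : clear implicits.

Definition diff_cohomology (p : nat) : set (set (cochain M I p p)) :=
  cohomology p p.
Arguments diff_cohomology : clear implicits.

(* The map C^r(p) -> C^r(p') (p' <= p) induced by the truncation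
   ZZ_D[p] -> ZZ_D[p'] forgetting the degrees > p'. It is the identity on
   underlying families, as the equality of C^r(p') ignores these degrees. *)
Definition trunc {r p : nat} (p' : nat) (x : cochain M I r p) :
    cochain M I r p' := x.

Definition trunc_class {r p : nat} (p' : nat) (A : set (cochain M I r p)) :
    set (cochain M I r p') :=
  [set y | exists2 x, A x & coh_class (trunc p' x) y].
Arguments trunc_class {r p} p' A _.

(* For p = n + 1, the inclusion of the flat classes
   H^(n-1)(M; U(1)) = H^n(C(n+1)) -> \hat H^n(M; ZZ). *)
Definition flat_incl {n p : nat} (A : set (cochain M I n p)) :
    set (cochain M I n n) :=
  trunc_class n A.

Definition massey_cochain {i j k : nat}
    (x : cochain M I i i) (z : cochain M I k k)
    (a : cochain M I (i + j).-1 (i + j)) (b : cochain M I (j + k).-1 (j + k)) :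
    cochain M I (i + j + k).-1 (i + j + k) :=
  (cup x b : cochain M I (i + j + k).-1 (i + j + k)) +
  (cup a z : cochain M I (i + j + k).-1 (i + j + k)) *~ (-1) ^+ i.-1.

(* Empty unless both products X Y and Y Z vanish. *)
Definition massey {i j k : nat} (X : set (cochain M I i i))
    (Y : set (cochain M I j j)) (Z : set (cochain M I k k)) :
    set (set (cochain M I (i + j + k).-1 (i + j + k).-1)) :=
  [set W | exists x y z
      (a : cochain M I (i + j).-1 (i + j)) (b : cochain M I (j + k).-1 (j + k)),
    [/\ X x, Y y & Z z] /\
    [/\ is_cochain a, is_cochain b,
      cochain_eq (cup x y) (D a : cochain M I (i + j) (i + j)),
      cochain_eq (cup y z) (D b : cochain M I (j + k) (j + k)) &
      W = flat_incl (coh_class (massey_cochain x z a b))]].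

(* Since ZZ_D[0] = ZZ, C(0) is the Cech complex of the sheaf ZZ. *)
Definition integral_class {p : nat} (x : cochain M I p p) :
    set (cochain M I p 0) :=
  coh_class (trunc 0 x).

End CechDeligne.

Arguments cohomology {R M I} U r p _.
Arguments diff_cohomology {R M I} U p _.

Record lie_group (R : realType) := LieGroup {
  gman :> manifold R;
  gmul : gman -> gman -> gman;
  ginv : gman -> gman;
  gone : gman;
  gmulA : associative gmul;
  gmul1 : left_id gone gmul;
  gmulV : left_inverse gone ginv gmul;
  gmul_smooth : @smooth_map R (prod_charted gman gman) gman setT
    (fun gh => gmul gh.1 gh.2);
  ginv_smooth : @smooth_map R gman gman setT ginv;
  gchart : cix gman;
  gchart1 : cdom gchart gone }.

(* The Lie algebra T_1 G, in the coordinates given by the chart [gchart G]. *)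
Definition lie_alg {R : realType} (G : lie_group R) : Type := 'rV[R]_(cdim G).

Section LieAlgebra.
Context {R : realType} (G : lie_group R).

Definition gcoord : G -> lie_alg G := cmap (gchart G).
Definition gpoint : lie_alg G -> G := cinv (gchart G).

Definition deriv1 {W : normedModType R} (f : G -> W) (v : lie_alg G) : W :=
  'D_v (f \o gpoint) (gcoord (gone G)).

Definition Ad (g : G) (v : lie_alg G) : lie_alg G :=
  deriv1 (fun h => gcoord (gmul (gmul g h) (ginv g))) v.

Definition lie_bracket (u v : lie_alg G) : lie_alg G :=
  deriv1 (fun h => Ad h v) u.

Definition invariant_poly (l : nat) (f : seq (lie_alg G) -> R) : Prop :=
  [/\ multilinear l f,
    (forall s t, size s = l -> perm_eq s t -> f s = f t) &
    forall g s, size s = l -> f (map (Ad g) s) = f s].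

End LieAlgebra.

Record principal_bundle {R : realType} (G : lie_group R) (M : manifold R) :=
  PrincipalBundle {
  ptot :> manifold R;
  pproj : ptot -> M;
  pact : ptot -> G -> ptot;
  pproj_smooth : @smooth_map R ptot M setT pproj;
  pact_smooth : @smooth_map R (prod_charted ptot G) ptot setT
    (fun ug => pact ug.1 ug.2);
  pact1 : forall u, pact u (gone G) = u;
  pactM : forall u g h, pact u (gmul g h) = pact (pact u g) h;
  pproj_act : forall u g, pproj (pact u g) = pproj u;
  (* a smooth local section, and the G-component of the trivialization that it
     defines *)
  ptriv : forall x : M, exists (W : set M) (s : M -> ptot) (h : ptot -> G),
    [/\ open W, W x,
      @smooth_map R M ptot W s,
      @smooth_map R ptot G (pproj @^-1` W) h &
      [/\ forall y, W y -> pproj (s y) = y,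
        forall u, W (pproj u) -> pact (s (pproj u)) (h u) = u &
        forall y g, W y -> h (pact (s y) g) = g]] }.

Section Connections.
Context {R : realType} {G : lie_group R} {M : manifold R}.
Context (P : principal_bundle G M).
Local Notation E := 'rV[R]_(cdim P).

Record connection := Connection {
  conn_form :> rform P (lie_alg G);
  conn_is_form : is_form 1 setT conn_form;
  conn_vertical : forall (a : cix P) (u : P) (v : lie_alg G), cdom a u ->
    conn_form a (cmap a u) [:: deriv1 (fun g => cmap a (pact u g)) v] = v;
  conn_equivariant : forall (a b : cix P) (u : P) (g : G) (v : E),
    cdom a u -> cdom b (pact u g) ->
    conn_form b (cmap b (pact u g))
      [:: 'D_v (fun y => cmap b (pact (cinv a y) g)) (cmap a u)] =
    Ad (ginv g) (conn_form a (cmap a u) [:: v]) }.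

(* F = dA + 1/2 [A, A], a 2-form on the total space. *)
Definition curvature (A : connection) : rform P (lie_alg G) :=
  fun a x vs => dR (conn_form A) a x vs +
    lie_bracket (conn_form A a x [:: nth 0 vs 0])
                (conn_form A a x [:: nth 0 vs 1]).

Fixpoint pairs {T : Type} (s : seq T) : seq (seq T) :=
  if s is u :: v :: t then [:: u; v] :: pairs t else [::].

(* The Chern-Weil form f(F, ..., F) on the total space (up to a normalization
   constant that can be absorbed in f). There is none in odd degree. *)
Definition chern_weil (f : seq (lie_alg G) -> R) (F : rform P (lie_alg G)) :
    rform P R :=
  fun a x vs => if odd (size vs) then 0 else
    \sum_(t : 'S_(size vs)) (-1) ^+ t *
      f (map (F a x) (pairs [seq nth 0 vs (t l) | l <- enum 'I_(size vs)])).

End Connections.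

Record bundle_map {R : realType} (G : lie_group R) (M N : manifold R)
    (P : principal_bundle G M) (Q : principal_bundle G N) (f : M -> N)
    (h : P -> Q) : Prop := {
  bm_smooth : @smooth_map R P Q setT h;
  bm_proj : forall u, pproj (h u) = f (pproj u);
  bm_act : forall u g, h (pact u g) = pact (h u) g }.

(* Pullback of integral cochains along f and a compatible map of indices. *)
Definition pull_int {R : realType} {M N : charted R} {I J : Type} (f : M -> N)
    (lam : I -> J) {r : nat} (z : cochain N J r 0) : cochain M I r 0 :=
  fun s => ((z (map lam s)).1 \o f, 0).

(* A degree i integral characteristic class of principal G-bundles: an element
   of H^i(M; ZZ), computed on any good open cover of M, for every bundle on every
   manifold M, natural with respect to bundle maps. *)
Record char_class {R : realType} (G : lie_group R) (i : nat) := CharClass {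
  cc :> forall (M : manifold R) (I : Type) (U : I -> set M),
    principal_bundle G M -> set (cochain M I i 0);
  cc_class : forall M I U P, good_cover U ->
    cohomology U i 0 (@cc M I U P);
  cc_natural : forall (M N : manifold R) (I J : Type) (U : I -> set M)
      (V : J -> set N) (P : principal_bundle G M) (Q : principal_bundle G N)
      (f : M -> N) (lam : I -> J) (h : P -> Q),
    good_cover U -> good_cover V ->
    @smooth_map R M N setT f -> (forall a, U a `<=` f @^-1` V (lam a)) ->
    bundle_map f h ->
    forall z, cc V Q z -> cc U P (pull_int f lam z) }.

Section Refinements.
Context {R : realType} {G : lie_group R} {M : manifold R} {I : Type}.
Context (U : I -> set M) (P : principal_bundle G M).

(* The curvature of a degree i cocycle x, locally the exterior derivative of its
   components of form degree i - 1, pulls back to the form w on the total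
   space. *)
Definition curvature_pullback {i : nat} (x : cochain M I i i) (w : rform P R) :
    Prop :=
  forall (c : I) (a : cix P) (b : cix M) (u : P) (vs : seq 'rV[R]_(cdim P)),
    cdom a u -> cdom b (pproj u) -> U c (pproj u) -> size vs = i ->
    dR (x [:: c]).2 b (cmap b (pproj u))
      [seq 'D_v (fun y => cmap b (pproj (cinv a y))) (cmap a u) | v <- vs] =
    w a (cmap a u) vs.

(* x = \hat c(F) is a Cech-Deligne cocycle refining c(P): its integral class is
   c(P) and its curvature is a Chern-Weil form of F. *)
Definition refines {i : nat} (c : char_class G i) (F : rform P (lie_alg G))
    (x : cochain M I i i) : Prop :=
  [/\ cocycle U x, integral_class U x = c M I U P &
    exists2 f, invariant_poly i./2 f & curvature_pullback x (chern_weil f F)].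

End Refinements.

(* Main.v *)
(* On Cech-Deligne cochains the differential D is a graded derivation for the cup
   product, and the cup product is associative.  Hence
     D (x u b) = (-1)^i x u D b = (-1)^i x u (y u z)
     D (a u z) = D a u z = (x u y) u z
   and the sign (-1)^(i-1) makes the two contributions cancel.  Both facts reduce
   to the Deligne-Beilinson product of local sections; as its form part is
   s /\ dt, the Leibniz rule and the associativity only need
   d (s /\ w) = ds /\ w for a closed form w, and d o d = 0.  Passing to the
   truncation of the Deligne complex sends the class of a cocycle to the class of
   the same cocycle, so that the flat inclusion of [mu] is again represented by
   mu. *)

Require Import Defs.
From HB Require Import structures.
From mathcomp Require Import all_boot all_order all_algebra all_fingroup.
From mathcomp Require Import all_classical all_reals all_analysis.
From mathcomp Require Import ring lra zify.
Import Order.TTheory GRing.Theory Num.Theory.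
Import numFieldNormedType.Exports.

Set Implicit Arguments.
Unset Strict Implicit.
Unset Printing Implicit Defensive.

Local Open Scope classical_set_scope.
Local Open Scope ring_scope.

(** * Shuffle products and alternating sums over lists *)

(** Derivatives obey their usual rules only for smooth functions, and local sections agree only over
    a given open set. So right additivity of the product, the Leibniz rule and associativity are
    relations [dsec_eq] between actual sections ([is_dsec]), chained by transitivity, and one must
    know that d and the products preserve sections. The costly point is that dw is again a form. Its
    compatibility with a change of charts needs a chain rule for w in which the vector arguments
    move with the point, and the symmetry of the second derivatives of the transition maps; the same
    symmetry gives d o d = 0. The definitions of d and of the wedge product sum over positions and
    masks. Recast as the recursions [altsum] and [shuffle] on the list of vectors, they yield
    multilinearity, alternation, associativity and the Leibniz rule by induction on that list. *)

(* [altsum F [:: v_0; ...; v_k]] is the alternating sum of the F v_l (del l vs);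
   the exterior derivative is the case F v r = 'D_v (w ^~ r). *)
Fixpoint altsum {T : Type} {K : zmodType} (F : T -> seq T -> K) (vs : seq T) :
    K :=
  if vs is v :: vs' then F v vs' - altsum (fun u r => F u (v :: r)) vs' else 0.

(* The sum over (p, _)-shuffles defining the wedge product, by recursion on
   whether the first vector goes to f, or to g past p arguments of f. *)
Fixpoint shuffle {T : Type} {K : comPzRingType} (p : nat) (f g : seq T -> K)
    (vs : seq T) : K :=
  if vs is v :: vs' then
    (if p is p'.+1 then shuffle p' (fun r => f (v :: r)) g vs' else 0) +
    (-1) ^+ p * shuffle p f (fun r => g (v :: r)) vs'
  else if p is 0 then f [::] * g [::] else 0.

Lemma altsumE {R : pzRingType} {V : lmodType R} {T : Type} (x0 : T)
    (F : T -> seq T -> V) (vs : seq T) :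
  altsum F vs =
  \sum_(l < size vs) (-1) ^+ l *: F (nth x0 vs l) (del l vs).
Proof.
elim: vs F => [|v vs IH] F /=; first by rewrite big_ord0.
rewrite big_ord_recl /= scale1r /del /= drop0; congr (_ + _).
rewrite IH -sumrN; apply: eq_bigr => l _; rewrite /bump leq0n add0n add1n.
by rewrite exprS mulN1r scaleNr.
Qed.

(** An inversion is an unselected entry standing before a selected one, so an unselected head
    contributes one inversion for each selected entry of the tail. *)
Lemma shuffle_inv_cons (b : bool) (m : bitseq) :
  shuffle_inv (b :: m) = (shuffle_inv m + ~~ b * count id m)%N.
Proof.
rewrite /shuffle_inv /= big_mkcond big_ord_recl /= /= if_same add0n.
rewrite (eq_bigr (fun l : 'I_(size m) =>
   (if nth false m l then count negb (take l m) else 0) +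
   ~~ b * nth false m l)%N); last first.
  move=> l _; rewrite add0n.
  by case: (nth _ _ _); case: b => /=; rewrite ?addn0 // addnC.
rewrite big_split /= -big_mkcond -big_distrr /=; congr (_ + _ * _)%N.
by elim: m => [|c m IH]; rewrite ?big_ord0 // big_ord_recl /= IH.
Qed.

Lemma sum_tuple_cons {V : nmodType} {T : finType} (n : nat)
    (P : pred (seq T)) (F : seq T -> V) :
  \sum_(m : n.+1.-tuple T | P m) F m =
  \sum_(b : T) \sum_(m : n.-tuple T | P (b :: m)) F (b :: m).
Proof.
rewrite pair_big_dep /=.
rewrite (reindex (fun bm : T * n.-tuple T => [tuple of bm.1 :: bm.2])) //=.
exists (fun m => (thead m, [tuple of behead m])) => [[b m] _|m _] /=.
  by congr (_, _); apply: val_inj.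
by rewrite [RHS]tuple_eta; apply: val_inj.
Qed.

(** The masks are split by their first bit. An unselected first vector precedes all p selected ones,
    whence the factor (-1)^p in the recursion. *)
Lemma shuffleE {T : Type} {K : comPzRingType} (p : nat) (f g : seq T -> K)
    (vs : seq T) :
  shuffle p f g vs =
  \sum_(m : (size vs).-tuple bool | count id m == p)
    (-1) ^+ shuffle_inv m * f (mask m vs) * g (mask (map negb m) vs).
Proof.
elim: vs p f g => [|v vs IH] p f g /=.
  case: p => [|p].
    rewrite (big_pred1 [tuple]) => [|m]; last by rewrite tuple0.
    by rewrite /shuffle_inv big_ord0 mul1r.
  by rewrite big_pred0 // => m; rewrite tuple0.
rewrite (sum_tuple_cons _ (fun m => count id m == p) (fun m =>
  (-1) ^+ shuffle_inv m * f (mask m (v :: vs)) *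
   g (mask (map negb m) (v :: vs)))) big_bool /=; congr (_ + _).
  case: p => [|p]; first by rewrite big_pred0.
  rewrite IH; apply: eq_big => [m|m _]; first by rewrite add1n eqSS.
  by rewrite shuffle_inv_cons addn0.
rewrite IH big_distrr; apply: eq_bigr => m /eqP mp /=.
by rewrite shuffle_inv_cons mul1n mp addnC exprD !mulrA.
Qed.

(** Two forms of degree k are only compared on lists of size k; this is the congruence that respects
    that restriction. *)
Lemma eq_shuffle {T : Type} {K : comPzRingType} (p : nat)
    (f f' g g' : seq T -> K) (vs : seq T) :
  (forall r, size r = p -> f r = f' r) ->
  (forall r, (size r + p)%N = size vs -> g r = g' r) ->
  shuffle p f g vs = shuffle p f' g' vs.
Proof.
elim: vs p f f' g g' => [|v vs IH] [|p] f f' g g' ff gg //=.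
- by rewrite ff // gg.
- by congr (_ + _ * _); apply: IH => [r /ff //|r] sr; apply: gg; rewrite /= -sr.
congr (_ + _ * _); apply: IH => r sr.
- by apply: ff; rewrite /= sr.
- by apply: gg; rewrite addnS sr.
- exact: ff.
- by apply: gg; rewrite /= -sr.
Qed.

Section Shuffle.
Context {T : Type} {K : comPzRingType}.
Implicit Types (f g h : seq T -> K) (vs : seq T) (c : K).

Lemma shuffleDl p f f' g vs :
  shuffle p (fun r => f r + f' r) g vs = shuffle p f g vs + shuffle p f' g vs.
Proof.
elim: vs p f f' g => [|v vs IH] [|p] f f' g /=; rewrite ?IH; ring.
Qed.

Lemma shuffleDr p f g g' vs :
  shuffle p f (fun r => g r + g' r) vs = shuffle p f g vs + shuffle p f g' vs.
Proof.
elim: vs p f g g' => [|v vs IH] [|p] f g g' /=; rewrite ?IH; ring.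
Qed.

Lemma shuffleZl p c f g vs :
  shuffle p (fun r => c * f r) g vs = c * shuffle p f g vs.
Proof. by elim: vs p f g => [|v vs IH] [|p] f g /=; rewrite ?IH; ring. Qed.

Lemma shuffleZr p c f g vs :
  shuffle p f (fun r => c * g r) vs = c * shuffle p f g vs.
Proof. by elim: vs p f g => [|v vs IH] [|p] f g /=; rewrite ?IH; ring. Qed.

Lemma shuffle0l p g vs : shuffle p (fun=> 0) g vs = 0.
Proof. by elim: vs p g => [|v vs IH] [|p] g /=; rewrite ?IH; ring. Qed.

Lemma shuffle0r p f vs : shuffle p f (fun=> 0) vs = 0.
Proof. by elim: vs p f => [|v vs IH] [|p] f /=; rewrite ?IH; ring. Qed.

Lemma shuffle_map {S : Type} (L : S -> T) p f g (vs : seq S) :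
  shuffle p f g (map L vs) =
  shuffle p (fun r => f (map L r)) (fun r => g (map L r)) vs.
Proof.
by elim: vs p f g => [|v vs IH] [|p] f g //=; rewrite !IH.
Qed.

Lemma shuffle_small p f g vs : (size vs < p)%N -> shuffle p f g vs = 0.
Proof.
elim: vs p f g => [|v vs IH] [|p] f g //= sp.
by rewrite !IH ?mulr0 ?addr0 // ltnW.
Qed.

(** On both sides the first vector goes to f, g or h, with signs 1, (-1)^p and (-1)^(p+q); the
    induction hypothesis handles each case. *)
Lemma shuffleA p q f g h vs :
  shuffle p f (shuffle q g h) vs = shuffle (p + q) (shuffle p f g) h vs.
Proof.
elim: vs p q f g h => [|v vs IH] p q f g h /=.
  by case: p q => [|p] [|q] //=; ring.
rewrite shuffleDr shuffleZr.
case: p q => [|p] [|q] //=.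
- by rewrite !IH shuffle0r !addn0 /=; ring.
- by rewrite shuffleDl shuffleZl shuffle0l !IH !add0n; ring.
- rewrite shuffleDl shuffleZl !IH !addn0 shuffle0r.
  (* Here q = 0, so g cannot receive the first vector: the remaining p vectors are too few for the p
     + 1 arguments of f. *)
  rewrite (@eq_shuffle _ _ p (shuffle p.+1 f _) (fun=> 0) h h) //.
    by rewrite shuffle0l; ring.
  by move=> r sr; rewrite shuffle_small // sr.
rewrite shuffleDl shuffleZl !IH !addSn !addnS !exprS exprD; ring.
Qed.

Lemma eq_altsum {V : zmodType} (F G : T -> seq T -> V) vs :
  (forall v r, (size r).+1 = size vs -> F v r = G v r) ->
  altsum F vs = altsum G vs.
Proof.
elim: vs F G => //= v vs IH F G FG; rewrite FG //; congr (_ - _).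
by apply: IH => u r sr; apply: FG; rewrite /= sr.
Qed.

Lemma altsumD {V : zmodType} (F G : T -> seq T -> V) vs :
  altsum (fun v r => F v r + G v r) vs = altsum F vs + altsum G vs.
Proof.
elim: vs F G => [|v vs IH] F G /=; rewrite ?addr0 // IH opprD.
by rewrite addrACA.
Qed.

Lemma altsum0 {V : zmodType} vs : altsum (fun _ _ => 0 : V) vs = 0.
Proof. by elim: vs => //= _ vs ->; exact: subr0. Qed.

Lemma altsumN {V : zmodType} (F : T -> seq T -> V) vs :
  altsum (fun v r => - F v r) vs = - altsum F vs.
Proof. by elim: vs F => [|v vs IH] F /=; rewrite ?oppr0 // IH opprD. Qed.

Lemma altsumZ c (F : T -> seq T -> K) vs :
  altsum (fun v r => c * F v r) vs = c * altsum F vs.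
Proof. by elim: vs F => [|v vs IH] F /=; rewrite ?mulr0 // IH; ring. Qed.

(* Used with B u v = 'D_u 'D_v w for d o d = 0, and with second derivatives of a
   transition map for the compatibility of d with changes of charts. *)
Lemma altsum_altsum {V : zmodType} (B : T -> T -> seq T -> V) vs :
  (forall u v r, (size r).+2 = size vs -> B u v r = B v u r) ->
  altsum (fun u => altsum (B u)) vs = 0.
Proof.
elim: vs B => //= v vs IH B Bsym; rewrite altsumD altsumN.
rewrite IH ?oppr0 ?addr0 => [|u w r sr]; last by apply: Bsym; rewrite /= -sr.
apply/eqP; rewrite subr_eq0; apply/eqP/eq_altsum => u r sr.
by apply: Bsym; rewrite sr.
Qed.

(** This is the term dw /\ w' of the Leibniz rule. The extracted vector becomes the first argument
    of the left factor, at no cost in sign. *)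
Lemma altsum_shufflel p (F : T -> seq T -> K) g vs :
  altsum (fun v => shuffle p (F v) g) vs = shuffle p.+1 (altsum F) g vs.
Proof.
elim: vs p F g => [|v vs IH] p F g //=.
rewrite shuffleDl altsumD altsumZ IH.
have -> : shuffle p (fun r => - altsum (fun u r0 => F u (v :: r0)) r) g vs =
   - shuffle p (altsum (fun u r0 => F u (v :: r0))) g vs.
  rewrite -mulN1r -shuffleZl; by apply: eq_shuffle => // r _; rewrite mulN1r.
case: p => [|p]; last by rewrite IH !exprS; ring.
rewrite exprS.
have -> : shuffle 0 (altsum (fun u r0 => F u (v :: r0))) g vs = 0.
  rewrite -(shuffle0l 0 g vs); apply: eq_shuffle => // -[] //.
by rewrite altsum0; ring.
Qed.

(** This is the term w /\ dw' of the Leibniz rule. The extracted vector has to pass the p arguments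
    of f to reach the right factor. *)
Lemma altsum_shuffler p f (G : T -> seq T -> K) vs :
  altsum (fun v => shuffle p f (G v)) vs =
  (-1) ^+ p * shuffle p f (altsum G) vs.
Proof.
elim: vs p f G => [|v vs IH] p f G //=.
  by case: p => [|p]; rewrite ?mulr0.
rewrite shuffleDr altsumD altsumZ IH.
have -> : shuffle p f (fun r => - altsum (fun u r0 => G u (v :: r0)) r) vs =
   - shuffle p f (altsum (fun u r0 => G u (v :: r0))) vs.
  rewrite -mulN1r -shuffleZr; by apply: eq_shuffle => // r _; rewrite mulN1r.
have sq : (-1) ^+ p * (-1) ^+ p = 1 :> K by rewrite -expr2 sqrr_sign.
case: p sq => [|p] sq.
  by rewrite altsum0; ring.
rewrite IH mulrDr !mulrA !sq [in RHS]exprS; ring.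
Qed.

End Shuffle.

(** * Multilinear and alternating functions of lists *)

Section Multilinear.
Context {R : realType} {V W : lmodType R}.
Implicit Types (f : seq V -> W) (s t r : seq V) (u v : V).

Lemma multilinear_cons k f v :
  multilinear k.+1 f -> multilinear k (fun r => f (v :: r)).
Proof. by move=> mf c u w s t st; rewrite -!cat_cons mf //= addSn st. Qed.

Lemma multilinear_head k f c u v r : multilinear k f -> (size r).+1 = k ->
  f (c *: u + v :: r) = c *: f (u :: r) + f (v :: r).
Proof. by move=> mf sr; apply: (mf c u v [::] r). Qed.

(** For multilinear functions this is equivalent to [alternating], and it suits induction on lists,
    where equal neighbours are visible at the head. *)
Definition adjacent_alternating k f :=
  forall u s t, (size s + size t).+2 = k -> f (s ++ u :: u :: t) = 0.

(** Polarization: expand f at the repeated argument u + v. *)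
Lemma adjacent_swap k f u v s t :
  multilinear k f -> adjacent_alternating k f -> (size s + size t).+2 = k ->
  f (s ++ u :: v :: t) = - f (s ++ v :: u :: t).
Proof.
move=> mf af st.
have mf1 w1 w2 w3 : f (s ++ w1 + w2 :: w3 :: t) =
    f (s ++ w1 :: w3 :: t) + f (s ++ w2 :: w3 :: t).
  by rewrite -[w1 in LHS]scale1r mf ?scale1r //= addnS.
have mf2 w1 w2 w3 : f (s ++ w3 :: w1 + w2 :: t) =
    f (s ++ w3 :: w1 :: t) + f (s ++ w3 :: w2 :: t).
  rewrite -(cat_rcons w3 s (w1 + w2 :: t)) -[w1 in LHS]scale1r mf ?scale1r.
    by rewrite !cat_rcons.
  by rewrite size_rcons addSn.
have := af (u + v) s t st.
by rewrite mf1 !mf2 !af // addr0 add0r => /eqP; rewrite addr_eq0 => /eqP.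
Qed.

(** Successive swaps bring the two equal entries next to each other, changing only the sign. *)
Lemma alternating_of_adjacent k f :
  multilinear k f -> adjacent_alternating k f -> Defs.alternating k f.
Proof.
move=> mf af u s t r; elim: t s => [|w t IH] s str.
  by apply: af; rewrite -str addn0.
rewrite /= (adjacent_swap _ _ mf af); last first.
  by rewrite -str /= size_cat /= !addnS !addSn !addnA.
rewrite -cat_rcons IH ?oppr0 // size_rcons -str /=.
by rewrite !addSn addnS addSn.
Qed.

Lemma adjacent_of_alternating k f :
  Defs.alternating k f -> adjacent_alternating k f.
Proof.
by move=> af u s t st; apply: (af u s [::] t); rewrite /= addn0.
Qed.

End Multilinear.

Lemma alternating_cons {R : realType} {V W : lmodType R} k (f : seq V -> W) v :
  Defs.alternating k.+1 f -> Defs.alternating k (fun r => f (v :: r)).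
Proof. by move=> af u s t r st; apply: (af u (v :: s)); rewrite /= -st. Qed.

(* The terms of a derivative of w (phi y) (map (L ^~ y) vs) in y that come from
   the vector arguments, H v being the derivative of L v. *)
Fixpoint slotsum {S T : Type} {W : zmodType} (L H : S -> T) (f : seq T -> W)
    (vs : seq S) : W :=
  if vs is v :: vs' then
    f (H v :: map L vs') + slotsum L H (fun r => f (L v :: r)) vs'
  else 0.

(** Moving the differentiated argument [H v] to the front costs one sign per argument passed. In
    this shape the second-derivative terms of a change of charts become accessible to
    [altsum_altsum]. *)
Lemma slotsum_altsum {R : realType} {V W : lmodType R} {S : Type}
    (L H : S -> V) (f : seq V -> W) (vs : seq S) :
  multilinear (size vs) f -> Defs.alternating (size vs) f ->
  slotsum L H f vs = altsum (fun u r => f (H u :: map L r)) vs.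
Proof.
elim: vs f => //= v vs IH f mf af.
rewrite IH; [|exact: multilinear_cons|exact: alternating_cons].
rewrite -altsumN; congr (_ + _); apply: eq_altsum => u r sr.
apply: (@adjacent_swap _ _ _ _ _ (L v) (H u) [::] _ mf).
  exact: adjacent_of_alternating.
by rewrite /= size_map sr.
Qed.

Section ShuffleMultilinear.
Context {R : realType} {V : lmodType R}.
Implicit Types (f g : seq V -> R).

Lemma scale_mul (c x : R) : c *: x = c * x. Proof. by []. Qed.

Lemma altsum_map {S T : Type} {W : zmodType} (L : S -> T) (F : T -> seq T -> W)
    vs :
  altsum F (map L vs) = altsum (fun v r => F (L v) (map L r)) vs.
Proof. by elim: vs F => //= v vs IH F; rewrite IH. Qed.

Lemma shuffle_multilinear p q f g :
  multilinear p f -> multilinear q g -> multilinear (p + q) (shuffle p f g).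
Proof.
move=> mf mg c u v s t; elim: s p q f g mf mg => [|w s IH] p q f g mf mg /= st.
  rewrite add0n in st.
  rewrite (@eq_shuffle _ _ p f f (fun r => g (c *: u + v :: r))
    (fun r => c * g (u :: r) + g (v :: r))) //; last first.
    by move=> r sr; apply: (multilinear_head _ _ _ mg); lia.
  rewrite shuffleDr shuffleZr /= scale_mul.
  case: p mf st => [|p] mf st; first by rewrite /=; ring.
  rewrite (@eq_shuffle _ _ p (fun r => f (c *: u + v :: r))
    (fun r => c * f (u :: r) + f (v :: r)) g g) //; last first.
    by move=> r sr; apply: (multilinear_head _ _ _ mf); rewrite sr.
  by rewrite shuffleDl shuffleZl; ring.
have e1 : shuffle p f (fun r => g (w :: r)) (s ++ c *: u + v :: t) =
    c * shuffle p f (fun r => g (w :: r)) (s ++ u :: t) +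
    shuffle p f (fun r => g (w :: r)) (s ++ v :: t).
  case: q mg st => [|q] mg st.
    by rewrite !(@shuffle_small _ _ p) ?size_cat /=; try lia; ring.
  by apply: (IH p q) => //; [exact: multilinear_cons|lia].
rewrite e1 scale_mul.
case: p mf st {e1} => [|p] mf st; first by ring.
by rewrite (IH p q) //; [rewrite scale_mul; ring|exact: multilinear_cons|lia].
Qed.

Lemma shuffle_alternating p q f g : multilinear p f -> multilinear q g ->
  Defs.alternating p f -> Defs.alternating q g ->
  Defs.alternating (p + q) (shuffle p f g).
Proof.
move=> mf mg /adjacent_of_alternating af /adjacent_of_alternating ag.
apply: alternating_of_adjacent; first exact: shuffle_multilinear.
move=> u s t {mf mg}; elim: s p q f g af ag => [|w s IH] p q f g af ag /= st.
  have e1 : shuffle p f (fun r => g (u :: u :: r)) t = 0.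
    rewrite -(shuffle0r p f t); apply: eq_shuffle => // r sr.
    by apply: (ag u [::] r); move: sr st; rewrite /=; lia.
  case: p af st e1 => [|p] af st e1; first by rewrite /= e1; ring.
  rewrite /= e1; case: p af st {e1} => [|p] af st; first by rewrite /= ; ring.
  rewrite (@eq_shuffle _ _ p (fun r => f (u :: u :: r)) (fun=> 0) g g) //.
    by rewrite shuffle0l !exprS; ring.
  by move=> r sr; apply: (af u [::] r); rewrite /= sr.
have e1 : shuffle p f (fun r => g (w :: r)) (s ++ u :: u :: t) = 0.
  case: q ag st => [|q] ag st.
    by rewrite shuffle_small ?size_cat //=; lia.
  apply: (IH p q) => //; last by lia.
  by move=> u' s' t' st'; apply: (ag u' (w :: s')); rewrite /= -st'.
rewrite e1 mulr0 addr0; case: p af st {e1} => // p af st.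
apply: (IH p q) => //; last by lia.
by move=> u' s' t' st'; apply: (af u' (w :: s')); rewrite /= -st'.
Qed.

Lemma altsum_scale {S : Type} {W : lmodType R} c (F : S -> seq S -> W) vs :
  altsum (fun v r => c *: F v r) vs = c *: altsum F vs.
Proof.
by elim: vs F => [|v vs IH] F /=; rewrite ?scaler0 // IH scalerBr.
Qed.

Lemma altsum_multilinear {W : lmodType R} k (F : V -> seq V -> W) :
  (forall r, size r = k -> linear (F ^~ r)) ->
  (forall v, multilinear k (F v)) ->
  multilinear k.+1 (altsum F).
Proof.
move=> lF mF c u v s t; elim: s k F lF mF => [|w s IH] k F lF mF /= [st].
  rewrite add0n in st; rewrite (lF _ st) scalerBr.
  rewrite (@eq_altsum _ _ (fun a r => F a (c *: u + v :: r))
    (fun a r => (c *: F a (u :: r)) + F a (v :: r))); last first.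
    by move=> a r sr; apply: (multilinear_head _ _ _ (mF _)); rewrite sr st.
  rewrite altsumD opprD addrACA; congr (_ - _ + _).
  exact: altsum_scale.
rewrite mF; last by lia.
case: k lF mF st => [|k] lF mF; first by lia.
rewrite addSn => -[st].
rewrite (IH k); [|by move=> r sr a b d; apply: lF; rewrite /= sr| |by rewrite st].
  by rewrite scalerBr opprD addrACA.
by move=> a; apply: multilinear_cons.
Qed.

(** Extracting either of the two equal neighbours leaves the same list with opposite signs; every
    other extraction leaves the pair in place. *)
Lemma altsum_adjacent {W : lmodType R} k (F : V -> seq V -> W) :
  (forall v, adjacent_alternating k (F v)) ->
  adjacent_alternating k.+1 (altsum F).
Proof.
move=> aF u s t; elim: s k F aF => [|w s IH] k F aF /= st.
  rewrite opprB addrCA subrr addr0.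
  rewrite -[RHS](altsum0 t).
  apply: eq_altsum => v r sr; apply: (aF v u [::]).
  by move: st; rewrite /= add0n => -[<-]; rewrite sr.
rewrite aF; last by move: st; lia.
rewrite (IH k.-1) ?subr0 //; last by lia.
by move=> v u' s' t' st'; apply: (aF v u' (w :: s')); move: st'; rewrite /=; lia.
Qed.

End ShuffleMultilinear.

(** * Smooth functions *)

Section Calculus.
Context {R : realType} {V W : normedModType R}.
Implicit Types (f g : V -> W) (A : set V) (x u v : V).

(** The difference g - f vanishes near x, so it is negligible there and its differential is 0. *)
Lemma near_eq_differentiable f g x :
  (\near x, f x = g x) -> differentiable f x -> differentiable g x.
Proof.
move=> fg df; pose h : V -> W := g - f.
have hx : h x = 0 by rewrite /h /= !fctE (nbhs_singleton fg) subrr.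
have ho : h \o shift x = cst (h x) + (0 : V -> W) +o_ 0 id.
  apply/eqaddoP => e e0; near=> y.
  rewrite !fctE /= hx addr0 subr0.
  have -> : h (y + x) = 0.
    rewrite /h !fctE; apply/eqP; rewrite subr_eq0 eq_sym; apply/eqP.
    near: y; have : \forall z \near x, f z = g z by [].
    by rewrite (near_shift 0 x) subr0.
  by rewrite normr0 mulr_ge0 // ltW.
have c0 : continuous (0 : V -> W) by exact: cst_continuous.
have dh : 'd h x = 0 :> (V -> W) by exact/diff_unique.
have -> : g = f + h by rewrite /h addrC subrK.
apply: differentiableD => //.
by apply/diff_locallyP; rewrite dh.
Unshelve. all: by end_near. Qed.

Lemma derive_lin f x (c : R) u v : differentiable f x ->
  'D_(c *: u + v) f x = c *: 'D_u f x + 'D_v f x.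
Proof. by move=> df; rewrite !deriveE // linearP. Qed.

Lemma smooth_on_sub (A B : set V) f : A `<=` B -> smooth_on B f -> smooth_on A f.
Proof. by move=> AB sf vs x /AB; apply: sf. Qed.

Lemma smooth_on_differentiable A f x :
  smooth_on A f -> A x -> differentiable f x.
Proof. by move=> sf; apply: (sf [::]). Qed.

Lemma smooth_on_derivable A f x v : smooth_on A f -> A x -> derivable f x v.
Proof. by move=> sf Ax; apply/diff_derivable/(smooth_on_differentiable sf). Qed.

Lemma smooth_on_derive A f v : smooth_on A f -> smooth_on A ('D_v f).
Proof.
by move=> sf vs x Ax; have := sf (rcons vs v) x Ax; rewrite foldr_rcons.
Qed.

Lemma open_near_derive A f g x v : open A -> A x ->
  (forall y, A y -> f y = g y) -> 'D_v f x = 'D_v g x.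
Proof.
move=> oA Ax fg; apply: near_eq_derive.
by apply: filterS (open_nbhs_nbhs (conj oA Ax)).
Qed.

(* A coinduction principle: a class of differentiable functions closed under
   directional derivatives consists of smooth functions. *)
Lemma smooth_on_ind A (C : (V -> W) -> Prop) : open A ->
  (forall f x, C f -> A x -> differentiable f x) ->
  (forall f v, C f -> exists2 g, C g & forall x, A x -> 'D_v f x = g x) ->
  forall f, C f -> smooth_on A f.
Proof.
move=> oA dC DC f Cf vs x Ax.
have [g Cg fg] : exists2 g, C g &
    forall y, A y -> foldr (fun v g => 'D_v g) f vs y = g y.
  elim: vs => [|v vs [g Cg fg]] /=; first by exists f.
  have [g' Cg' gg'] := DC _ v Cg; exists g' => // y Ay.
  by rewrite -gg' //; apply: (open_near_derive _ oA).
apply: (near_eq_differentiable _ (dC _ _ Cg Ax)).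
by apply: filterS (open_nbhs_nbhs (conj oA Ax)) => y /fg ->.
Qed.

Lemma eq_smooth_on A f g : open A -> (forall x, A x -> f x = g x) ->
  smooth_on A f -> smooth_on A g.
Proof.
move=> oA fg sf.
apply: (@smooth_on_ind A
  (fun g => exists2 f, smooth_on A f & forall x, A x -> f x = g x)) => //.
- move=> {f g fg sf} g x [f sf fg] Ax.
  apply: (near_eq_differentiable _ (smooth_on_differentiable sf Ax)).
  by apply: filterS (open_nbhs_nbhs (conj oA Ax)).
- move=> {f g fg sf} g v [f sf fg]; exists ('D_v f).
    by exists ('D_v f) => //; exact: smooth_on_derive.
  by move=> x Ax; apply/esym/(open_near_derive _ oA).
- by exists f.
Qed.

Lemma smooth_on_cst A (c : W) : open A -> smooth_on A (cst c).
Proof.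
move=> oA; apply: (@smooth_on_ind A (fun f => exists c, f = cst c)) => //.
- by move=> f x [{}c ->] _; exact: differentiable_cst.
- move=> f v [{}c ->]; exists (cst 0); first by exists 0.
  by move=> x _; rewrite derive_cst.
- by exists c.
Qed.

Lemma smooth_on_lin A (c : R) f g : open A -> smooth_on A f -> smooth_on A g ->
  smooth_on A (fun x => c *: f x + g x).
Proof.
move=> oA sf sg; apply: (@smooth_on_ind A (fun h => exists f g,
  [/\ smooth_on A f, smooth_on A g & h = c *: f + g])) => //.
- move=> _ x [{sf sg}f [{}g [sf sg ->]]] Ax.
  by apply: differentiableD; [apply: differentiableZ|];
    apply: smooth_on_differentiable Ax.
- move=> _ v [{sf sg}f [{}g [sf sg ->]]].
  exists (c *: 'D_v f + 'D_v g).
    by exists ('D_v f), ('D_v g); split=> //; exact: smooth_on_derive.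
  move=> x Ax; have := smooth_on_derivable (v := v) sf Ax.
  have := smooth_on_derivable (v := v) sg Ax => dg df.
  by rewrite deriveD ?deriveZ //; exact: derivableZ.
- by exists f, g.
Qed.

Lemma smooth_onD A f g : open A -> smooth_on A f -> smooth_on A g ->
  smooth_on A (fun x => f x + g x).
Proof.
move=> oA sf sg; have := smooth_on_lin 1 oA sf sg.
by under eq_fun do rewrite scale1r.
Qed.

Lemma smooth_onZ A (c : R) f : open A -> smooth_on A f ->
  smooth_on A (fun x => c *: f x).
Proof.
move=> oA sf; have := smooth_on_lin c oA sf (smooth_on_cst 0 oA).
by under eq_fun do rewrite addr0.
Qed.

Lemma smooth_onN A f : open A -> smooth_on A f -> smooth_on A (fun x => - f x).
Proof.
move=> oA sf; have := smooth_onZ (-1) oA sf.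
by under eq_fun do rewrite scaleN1r.
Qed.

End Calculus.

Lemma smooth_onM {R : realType} {V : normedModType R} (A : set V)
    (f g : V -> R) : open A -> smooth_on A f -> smooth_on A g ->
  smooth_on A (fun x => f x * g x).
Proof.
(* Products alone are not stable under derivation; finite sums of products of smooth functions are,
   so they form the class used for the coinduction. *)
move=> oA sf sg; pose C (h : V -> R) := exists2 s : seq ((V -> R) * (V -> R)),
  (forall i, (i < size s)%N ->
     smooth_on A (nth (cst 0, cst 0) s i).1 /\
     smooth_on A (nth (cst 0, cst 0) s i).2) &
  h = foldr (fun fg h => fg.1 * fg.2 + h) (cst 0) s.
apply: (@smooth_on_ind _ _ _ A C) => //.
- move=> _ x [s + ->] Ax; elim: s => [_|[a b] s IH sC] /=.
    exact: differentiable_cst.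
  have [sa sb] := sC 0%N isT.
  apply: differentiableD; last by apply: IH => i; exact: (sC i.+1).
  by apply: differentiableM; apply: smooth_on_differentiable Ax.
- move=> _ v [s + ->]; elim: s => [_|[a b] s IH sC] /=.
    exists (cst 0); first by exists [::].
    by move=> x _; rewrite derive_cst.
  have [sa sb] := sC 0%N isT.
  have [i|_ [s' sC' ->] ss'] := IH; first exact: (sC i.+1).
  exists (a * 'D_v b + ('D_v a * b +
      foldr (fun fg h => fg.1 * fg.2 + h) (cst 0) s')).
    exists ((a, 'D_v b) :: ('D_v a, b) :: s') => //.
    by move=> [|[|i]] //= lti; [split=> //; exact: smooth_on_derive..|exact: sC'].
  move=> x Ax.
  have da := smooth_on_derivable (v := v) sa Ax.
  have db := smooth_on_derivable (v := v) sb Ax.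
  rewrite deriveD; [|exact: derivableM|].
    rewrite deriveM // ss' // !fctE addrA.
    by congr (_ + _ + _); rewrite /= [RHS]mulrC.
  elim: s sC {IH ss' sa sb da db} => [_|[a' b'] s IH sC] /=.
    exact: derivable_cst.
  have [sa' sb'] := sC 1%N isT.
  apply: derivableD; first by apply: derivableM; apply: smooth_on_derivable Ax.
  by apply: IH => -[|i] lti; [exact: (sC 0%N)|exact: (sC i.+2)].
- exists [:: (f, g)]; last by apply/funext => x /=; rewrite !fctE /= addr0.
  by move=> [|] //.
Qed.

(** * Symmetry of second derivatives *)

Lemma half_dist_disjoint {R : realFieldType} (a b c : R) :
  `|a - c| < `|a - b| / 2%:R -> `|b - c| < `|a - b| / 2%:R -> False.
Proof.
move=> h1 h2; have := ler_distD c a b; rewrite (distrC c b).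
by apply/negP; rewrite -ltNge [ltRHS]splitr ltrD.
Qed.

Section Schwarz.
Context {R : realType} {V : normedModType R}.
Implicit Types (f : V -> R) (x u v : V).

Lemma is_derive_line f x v (t : R) : derivable f (t *: v + x) v ->
  is_derive t 1 (fun s => f (s *: v + x)) ('D_v f (t *: v + x)).
Proof.
move=> df.
have e : (fun h : R => h^-1 *: (((fun s => f (s *: v + x)) \o shift t) h%:A -
    f (t *: v + x))) =
  (fun h : R => h^-1 *: ((f \o shift (t *: v + x)) (h *: v) - f (t *: v + x))).
  by apply/funext => h /=; rewrite scalerDl addrA [h%:A]mulr1.
by apply: DeriveDef; [rewrite /derivable e|rewrite /derive e].
Qed.

Lemma mvt_line f x v (h : R) : 0 < h ->
  (forall t, 0 <= t <= h -> derivable f (t *: v + x) v) ->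
  exists2 t, 0 <= t <= h & f (h *: v + x) - f x = h * 'D_v f (t *: v + x).
Proof.
move=> h0 df.
have [|||t] := @MVT R (fun s => f (s *: v + x)) (fun t => 'D_v f (t *: v + x)) 0 h.
- exact: h0.
- move=> t; rewrite in_itv /= => /andP[t0 th]; apply/is_derive_line/df.
  by rewrite !ltW.
- apply: derivable_within_continuous => t; rewrite in_itv /= => th.
  by have [] := is_derive_line (df t th).
rewrite in_itv /= => /andP[t0 th]; rewrite scale0r add0r subr0 mulrC => e.
by exists t; rewrite ?ltW.
Qed.

(* The second difference of f on a parallelogram, evaluated by the mean value
   theorem; its symmetry in (u, v) is the source of derive_comm. *)
Lemma mvt_square f x u v (h : R) : 0 < h ->
  (forall s t, 0 <= s <= h -> 0 <= t <= h ->
     derivable f (s *: u + (t *: v + x)) u /\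
     derivable ('D_u f) (t *: v + (s *: u + x)) v) ->
  exists s t, [/\ 0 <= s <= h, 0 <= t <= h &
    f (h *: u + (h *: v + x)) - f (h *: v + x) - (f (h *: u + x) - f x) =
    h * (h * 'D_v ('D_u f) (t *: v + (s *: u + x)))].
Proof.
move=> h0 df; pose g y := f (h *: v + y) - f y.
have hh : 0 <= h <= h by rewrite lexx ltW.
have h00 : 0 <= (0 : R) <= h by rewrite lexx ltW.
have dg s : 0 <= s <= h ->
    is_derive (s *: u + x) u g
      ('D_u f (h *: v + (s *: u + x)) - 'D_u f (s *: u + x)).
  move=> sh; have [d1 _] := df s h sh hh; have [d2 _] := df s 0 sh h00.
  rewrite scale0r add0r in d2; rewrite addrCA in d1.
  apply: is_deriveB; last exact: derivableP.
  have e : (fun k : R => k^-1 *: (((fun y => f (h *: v + y)) \o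
      shift (s *: u + x)) (k *: u) - f (h *: v + (s *: u + x)))) =
    (fun k : R => k^-1 *: ((f \o shift (h *: v + (s *: u + x))) (k *: u) -
       f (h *: v + (s *: u + x)))).
    by apply/funext => k /=; rewrite addrCA.
  by apply: DeriveDef; [rewrite /derivable e|rewrite /derive e].
(* The second difference is the increment of g along u. One mean value in direction u turns it into
   an increment of 'D_u f along v, to which a second one applies. *)
have [s /dg ds|s sh gs] := @mvt_line g x u h h0; first exact: ex_derive.
have [t th|t th ft] := @mvt_line ('D_u f) (s *: u + x) v h h0.
  by have [] := df s t sh th.
exists s, t; split=> //; rewrite -ft.
have [_ ds] := dg s sh; rewrite -ds -gs /g !(addrCA (h *: u)); ring.
Qed.

(** The second difference of f on a small parallelogram does not depend on the order of u and v;
    evaluating it in both orders gives the two points. *)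
Lemma mixed_derive_meet f x u v (r : R) : 0 < r ->
  (forall y w z, ball x r y -> derivable f y w /\ derivable ('D_w f) y z) ->
  exists y1 y2, [/\ ball x r y1, ball x r y2 &
    'D_v ('D_u f) y1 = 'D_u ('D_v f) y2].
Proof.
(* With h = r / (2 N), a displacement by at most h along each of u and v stays within r / 2 of x.
   The summand 1 keeps N positive when u = v = 0. *)
move=> r0 df; pose N := `|u| + `|v| + 1.
have N0 : 0 < N by rewrite ltr_wpDl // addr_ge0.
pose h := r / 2 / N; have h0 : 0 < h by rewrite !divr_gt0.
have inball s t : 0 <= s <= h -> 0 <= t <= h -> ball x r (s *: u + (t *: v + x)).
  move=> /andP[s0 sh] /andP[t0 th].
  rewrite -ball_normE /= addrA opprD addrCA subrr addr0 normrN.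
  apply: le_lt_trans (ler_normD _ _) _; rewrite !normrZ !ger0_norm //.
  have : s * `|u| + t * `|v| <= h * N.
    have := ler_wpM2r (normr_ge0 u) sh; have := ler_wpM2r (normr_ge0 v) th.
    rewrite /N !mulrDr; lra.
  move=> /le_lt_trans; apply; rewrite /h divfK ?gt_eqF //; lra.
have [s t sh th|s1 [t1 [s1h t1h e1]]] := @mvt_square f x u v h h0.
  have [d1 d2] := df _ u v (inball s t sh th).
  by split; [exact: d1|rewrite addrCA; exact: d2].
have [s t sh th|s2 [t2 [s2h t2h e2]]] := @mvt_square f x v u h h0.
  have [d1 d2] := df _ v u (inball t s th sh).
  by split; [rewrite addrCA; exact: d1|exact: d2].
exists (t1 *: v + (s1 *: u + x)), (t2 *: u + (s2 *: v + x)); split.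
- by rewrite addrCA; exact: inball.
- exact: inball.
have hn0 : h != 0 by rewrite gt_eqF.
apply: (mulfI hn0); apply: (mulfI hn0).
by rewrite -e1 -e2 (addrCA (h *: u)); ring.
Qed.

(** If the two values differed, then by continuity each mixed derivative would stay, near x, within
    half their distance e of its own value at x. The common value provided by [mixed_derive_meet]
    would then be too close to both. *)
Lemma derive_comm (A : set V) f x u v : open A -> smooth_on A f -> A x ->
  'D_u ('D_v f) x = 'D_v ('D_u f) x.
Proof.
move=> oA sf Ax; apply/eqP; apply: contraT => ab.
pose e := `|'D_u ('D_v f) x - 'D_v ('D_u f) x| / 2.
have e0 : 0 < e by rewrite divr_gt0 ?normr_gt0 ?subr_eq0.
have near_second w z : \forall y \near x,
    `|'D_w ('D_z f) x - 'D_w ('D_z f) y| < e.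
  have s2 := smooth_on_derive w (smooth_on_derive z sf).
  have c2 := differentiable_continuous (smooth_on_differentiable s2 Ax).
  by move/cvgrPdist_lt: c2 => /(_ e e0).
have nbx : nbhs x [set y | [/\ A y,
    `|'D_u ('D_v f) x - 'D_u ('D_v f) y| < e &
    `|'D_v ('D_u f) x - 'D_v ('D_u f) y| < e]].
  apply: filterS3 (open_nbhs_nbhs (conj oA Ax)) (near_second u v)
    (near_second v u) => y Ay p q; exact: And3 Ay p q.
have [r /= r0 rP] := (nbhs_ballP _ _).1 nbx.
have [y w z yr|y1 [y2 [/rP[_ _ p1] /rP[_ p2 _]]]] :=
  @mixed_derive_meet f x u v r r0.
  have [Ay _ _] := rP _ yr; split; first exact: smooth_on_derivable sf Ay.
  exact: smooth_on_derivable (smooth_on_derive w sf) Ay.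
by move=> c; rewrite c in p1; case: (half_dist_disjoint p2 p1).
Qed.

End Schwarz.

(** * Differentiation of list operations *)

Section DeriveLists.
Context {R : realType} {V : normedModType R} {T : Type}.
Implicit Types (A : set V) (x d : V) (vs : seq T).

Lemma is_derive_altsum (G : V -> T -> seq T -> R) x d vs :
  (forall v r, (size r).+1 = size vs -> derivable (fun y => G y v r) x d) ->
  is_derive x d (fun y => altsum (G y) vs)
    (altsum (fun v r => 'D_d (fun y => G y v r) x) vs).
Proof.
elim: vs G => [|v vs IH] G dG /=; first exact: is_derive_cst.
apply: is_deriveB; first by apply: derivableP; apply: dG.
by apply: IH => u r sr; apply: dG; rewrite /= sr.
Qed.

Lemma smooth_on_altsum A (G : V -> T -> seq T -> R) vs : open A ->
  (forall v r, (size r).+1 = size vs -> smooth_on A (fun y => G y v r)) ->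
  smooth_on A (fun y => altsum (G y) vs).
Proof.
move=> oA; elim: vs G => [|v vs IH] G sG /=; first exact: smooth_on_cst.
apply: smooth_onD => //; first exact: sG.
by apply: smooth_onN => //; apply: IH => u r sr; apply: sG; rewrite /= sr.
Qed.

Lemma is_derive_shuffle p (f g : V -> seq T -> R) x d vs :
  (forall r, size r = p -> derivable (f ^~ r) x d) ->
  (forall r, (size r + p)%N = size vs -> derivable (g ^~ r) x d) ->
  is_derive x d (fun y => shuffle p (f y) (g y) vs)
    (shuffle p (fun r => 'D_d (f ^~ r) x) (g x) vs +
     shuffle p (f x) (fun r => 'D_d (g ^~ r) x) vs).
Proof.
elim: vs p f g => [|v vs IH] p f g df dg /=.
  case: p df dg => [|p] df dg; last by rewrite addr0; exact: is_derive_cst.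
  have /derivableP d1 := df [::] erefl; have /derivableP d2 := dg [::] erefl.
  apply: is_derive_eq; rewrite addrC /= -![_ *: _]/(_ * _); ring.
have d2 : is_derive x d
    (fun y => (-1) ^+ p * shuffle p (f y) (fun r => g y (v :: r)) vs)
    ((-1) ^+ p *
      (shuffle p (fun r => 'D_d (f ^~ r) x) (fun r => g x (v :: r)) vs +
       shuffle p (f x) (fun r => 'D_d (fun y => g y (v :: r)) x) vs)).
  apply: is_deriveZ; apply: IH => // r sr; apply: dg; by rewrite /= -sr.
case: p df dg d2 => [|p] df dg d2.
  rewrite !add0r -mulrDr; under eq_fun do rewrite add0r; exact: d2.
rewrite addrACA -mulrDr; apply: is_deriveD.
apply: (IH p (fun y r => f y (v :: r)) g) => r sr.
  by apply: df; rewrite /= sr.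
by apply: dg; rewrite /= -sr addnS.
Qed.

Lemma smooth_on_shuffle A p (f g : V -> seq T -> R) vs : open A ->
  (forall r, size r = p -> smooth_on A (f ^~ r)) ->
  (forall r, (size r + p)%N = size vs -> smooth_on A (g ^~ r)) ->
  smooth_on A (fun y => shuffle p (f y) (g y) vs).
Proof.
move=> oA; elim: vs p f g => [|v vs IH] p f g sf sg /=.
  case: p sf sg => [|p] sf sg; last exact: smooth_on_cst.
  by apply: smooth_onM => //; [exact: sf|exact: sg].
apply: smooth_onD => //; last first.
  apply: smooth_onM => //; first exact: smooth_on_cst.
  by apply: IH => // r sr; apply: sg; rewrite /= -sr.
case: p sf sg => [|p] sf sg; first exact: smooth_on_cst.
apply: (IH p (fun y r => f y (v :: r)) g) => r sr.
  by apply: sf; rewrite /= sr.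
by apply: sg; rewrite /= -sr addnS.
Qed.

End DeriveLists.

Lemma is_derive_sum_fun {R : realType} {V W : normedModType R} n
    (h : 'I_n -> V -> W) (x d : V) (dh : 'I_n -> W) :
  (forall i, is_derive x d (h i) (dh i)) ->
  is_derive x d (fun y => \sum_(i < n) h i y) (\sum_(i < n) dh i).
Proof.
move=> hd; have -> : (fun y => \sum_(i < n) h i y) = \sum_(i < n) h i.
  by apply/funext => y; rewrite fct_sumE.
exact: is_derive_sum.
Qed.

Lemma is_derive_comp {R : realType} {U V W : normedModType R} (f : U -> V)
    (g : V -> W) x d : differentiable f x -> differentiable g (f x) ->
  is_derive x d (g \o f) ('D_('D_d f x) g (f x)).
Proof.
move=> df dg; have dgf := differentiable_comp df dg.
apply: DeriveDef; first exact: diff_derivable.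
rewrite (@deriveE _ _ _ _ _ d dgf) (@deriveE _ _ _ _ _ d df).
by rewrite (@deriveE _ _ _ _ _ _ dg) (diff_comp df dg).
Qed.

(** * Chain rule with moving vector arguments *)

Section SlotChainRule.
Context {R : realType} {V : normedModType R} {n : nat} {S : Type}.
Local Notation E := 'rV[R]_n.

(** Trades a moving vector argument for fixed basis vectors with scalar coefficients, so that the
    ordinary product rule applies. *)
Lemma multilinear_expand k (f : seq E -> R) (u : E) (r : seq E) :
  multilinear k.+1 f -> size r = k ->
  f (u :: r) = \sum_(j < n) u 0 j * f (delta_mx 0 j :: r).
Proof.
move=> mf sr; rewrite {1}(row_sum_delta u).
have f0 : f (0 :: r) = 0.
  have := multilinear_head 1 0 0 mf (congr1 succn sr).
  rewrite scale1r addr0 scale1r => /eqP.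
  by rewrite -subr_eq0 opprD addrA subrr sub0r oppr_eq0 => /eqP.
elim/big_rec2 : _ => // j y z _ <-.
by rewrite (multilinear_head _ _ _ mf) ?sr.
Qed.

Lemma eq_slotsum {T : Type} {W : zmodType} (L H : S -> T) (f g : seq T -> W) vs :
  (forall r, size r = size vs -> f r = g r) ->
  slotsum L H f vs = slotsum L H g vs.
Proof.
elim: vs f g => //= v vs IH f g fg; rewrite fg /= ?size_map //; congr (_ + _).
by apply: IH => r sr; apply: fg; rewrite /= sr.
Qed.

Lemma slotsum_sum {T : Type} m (c : 'I_m -> R) (L H : S -> T)
    (f : 'I_m -> seq T -> R) vs :
  slotsum L H (fun r => \sum_(j < m) c j * f j r) vs =
  \sum_(j < m) c j * slotsum L H (f j) vs.
Proof.
elim: vs f => [|v vs IH] f /=; first by rewrite big1 // => j _; rewrite mulr0.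
by rewrite IH -big_split; apply: eq_bigr => j _ /=; rewrite mulrDr.
Qed.

Lemma derive_multilinear k (B : set E) (w : E -> seq E -> R) (z d : E) :
  open B -> B z -> (forall y, B y -> multilinear k (w y)) ->
  (forall r, size r = k -> differentiable (w ^~ r) z) ->
  multilinear k (fun r => 'D_d (w ^~ r) z).
Proof.
move=> oB Bz mw dw c u v s t st.
rewrite (open_near_derive d oB Bz (g := fun y => c * w y (s ++ u :: t) +
  w y (s ++ v :: t))); last by move=> y By; rewrite mw.
have d2 e : derivable (w^~ (s ++ e :: t)) z d.
  by apply: diff_derivable; apply: dw; rewrite size_cat /= addnS.
rewrite deriveD //; last exact: derivableZ (d2 u).
by congr (_ + _); apply: deriveZ (d2 u).
Qed.

(** Differentiability of w is only available for a fixed list of vectors. The first argument is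
    therefore expanded in the standard basis: each summand is a scalar coordinate of [psi v] times w
    with a fixed first vector, which the induction hypothesis covers. *)
Lemma is_derive_slots (A : set V) (B : set E) (phi : V -> E)
    (w : E -> seq E -> R) (psi : S -> V -> E) (x d : V) (vs : seq S) :
  open A -> open B -> A x -> (forall y, A y -> B (phi y)) ->
  differentiable phi x -> (forall v, derivable (psi v) x d) ->
  (forall z, B z -> multilinear (size vs) (w z)) ->
  (forall r, size r = size vs -> differentiable (w ^~ r) (phi x)) ->
  is_derive x d (fun y => w (phi y) [seq psi v y | v <- vs])
    ('D_('D_d phi x) (w ^~ [seq psi v x | v <- vs]) (phi x) +
     slotsum (psi ^~ x) (fun v => 'D_d (psi v) x) (w (phi x)) vs).
Proof.
move=> oA oB Ax AB dphi dpsi; elim: vs w => [|v vs IH] w mw dw /=.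
  have dw0 := dw [::] erefl.
  by rewrite addr0; exact: (is_derive_comp _ dphi dw0).
have sL y : size [seq psi v y | v <- vs] = size vs by rewrite size_map.
have key : is_derive x d (fun y => \sum_(j < n) psi v y 0 j *
    w (phi y) (delta_mx 0 j :: [seq psi v y | v <- vs]))
  (\sum_(j < n) (psi v x 0 j *
      ('D_('D_d phi x) (w ^~ (delta_mx 0 j :: [seq psi v x | v <- vs])) (phi x) +
        slotsum (psi ^~ x) (fun v => 'D_d (psi v) x)
          (fun r => w (phi x) (delta_mx 0 j :: r)) vs) +
     'D_d (psi v) x 0 j *
        w (phi x) (delta_mx 0 j :: [seq psi v x | v <- vs]))).
  apply: is_derive_sum_fun => j.
  have d1 : is_derive x d (fun y => psi v y 0 j) ('D_d (psi v) x 0 j).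
    apply: DeriveDef; first by have /derivable_mxP := dpsi v; exact.
    by rewrite (derive_mx (dpsi v)) mxE.
  have d2 := IH (fun z r => w z (delta_mx 0 j :: r))
    (fun z Bz => multilinear_cons (delta_mx 0 j) (mw z Bz))
    (fun r sr => dw (delta_mx 0 j :: r) (congr1 succn sr)).
  apply: is_derive_eq; congr (_ + _); exact: mulrC.
have near_sum : \near x, \sum_(j < n) psi v x 0 j *
    w (phi x) (delta_mx 0 j :: [seq psi v x | v <- vs]) =
    w (phi x) (psi v x :: [seq psi v x | v <- vs]).
  apply: filterS (open_nbhs_nbhs (conj oA Ax)) => y Ay.
  by rewrite (multilinear_expand _ (mw _ (AB _ Ay))) ?sL.
apply: (near_eq_is_derive near_sum); apply: is_derive_eq.
(* The derivative of w in its base point is again multilinear, so the expected answer can be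
   expanded in the same basis and compared coordinate by coordinate. *)
have mD := derive_multilinear ('D_d phi x) oB (AB _ Ax) mw dw.
rewrite big_split /= -(multilinear_expand _ (mw _ (AB _ Ax))) ?sL //.
rewrite (multilinear_expand _ mD) ?sL // (@eq_slotsum _ _ _ _ _ (fun r =>
  \sum_(j < n) psi v x 0 j * w (phi x) (delta_mx 0 j :: r))); last first.
  by move=> r sr; rewrite (multilinear_expand _ (mw _ (AB _ Ax))) ?sr.
rewrite slotsum_sum [X in _ = _ + X]addrC addrA -big_split /=.
by congr (_ + _); apply: eq_bigr => j _; rewrite mulrDr.
Qed.

End SlotChainRule.

(** * Differential forms *)

Section Coordinates.
Context {R : realType} {V : normedModType R} {n : nat}.
Implicit Types (f : V -> 'rV[R]_n) (A : set V).

Lemma derive_coord f x v i : derivable f x v ->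
  'D_v (fun y => f y 0 i) x = 'D_v f x 0 i.
Proof. by move=> df; rewrite (derive_mx df) mxE. Qed.

Lemma smooth_on_coord A f i : open A -> smooth_on A f ->
  smooth_on A (fun y => f y 0 i).
Proof.
move=> oA sf; apply: (@smooth_on_ind _ _ _ A
  (fun h : V -> R => exists2 f : V -> 'rV[R]_n,
     smooth_on A f & h = fun y => f y 0 i)) => //.
- move=> _ x [{sf}f sf ->] Ax.
  apply: (differentiable_comp (g := fun N : 'rV[R]_n => N 0 i : R)).
    exact: smooth_on_differentiable Ax.
  exact: differentiable_coord.
- move=> _ v [{sf}f sf ->]; exists (fun y => 'D_v f y 0 i).
    by exists ('D_v f) => //; exact: smooth_on_derive.
  by move=> x Ax; apply: derive_coord; apply: smooth_on_derivable Ax.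
- by exists f.
Qed.

Lemma derive_comm_rV A f x u v : open A -> smooth_on A f -> A x ->
  'D_u ('D_v f) x = 'D_v ('D_u f) x.
Proof.
move=> oA sf Ax; apply/rowP => i.
have e w z : 'D_w ('D_z f) x 0 i = 'D_w ('D_z (fun y => f y 0 i)) x.
  rewrite -derive_coord.
    apply: (open_near_derive _ oA Ax) => y Ay.
    by rewrite -derive_coord //; apply: smooth_on_derivable Ay.
  by apply: smooth_on_derivable Ax; exact: smooth_on_derive.
apply: etrans (e u v) _; apply: etrans (esym (e v u)).
have sc := smooth_on_coord i oA sf.
exact: derive_comm oA sc Ax.
Qed.

End Coordinates.

Lemma smooth_on_near_cst {R : realType} {V W : normedModType R} (A : set V)
    (f : V -> W) : open A ->
  (forall x, A x -> \forall y \near x, f y = f x) -> smooth_on A f.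
Proof.
move=> oA cf; apply: (@smooth_on_ind _ _ _ A
  (fun f => forall x, A x -> \forall y \near x, f y = f x)) => //.
- move=> {cf}f x cf Ax.
  apply: (near_eq_differentiable _ (differentiable_cst (f x) x)).
  by apply: filterS (cf x Ax) => y.
- move=> {cf}f v cf; exists (cst 0); first by move=> x _; exact: nearW.
  move=> x Ax; rewrite -(derive_cst (f x) x v); exact: near_eq_derive (cf x Ax).
Qed.

Section Regions.
Context {R : realType} {M : charted R} (hM : smooth_manifold M).
Implicit Types (U : set M) (a b : cix M).
Local Notation E := 'rV[R]_(cdim M).

Lemma cregE a U :
  creg a U = [set x : E | creg a setT x /\ U (cinv a x)].
Proof.
apply/seteqP; split=> [x [p [ap Up] <-]|x [[p [ap _] <-]]].
  by split; [exists p|rewrite (sm_mapK hM)].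
by rewrite (sm_mapK hM) // => Up; exists p.
Qed.

Lemma creg_cinv a U x : creg a U x -> cdom a (cinv a x) /\ U (cinv a x).
Proof. by case=> p [ap Up] <-; rewrite (sm_mapK hM). Qed.

Lemma creg_sub a U (U' : set M) : U `<=` U' -> creg a U `<=` creg a U'.
Proof. by move=> UU' x [p [ap Up] <-]; exists p => //; split=> //; exact: UU'. Qed.

Lemma cinv_continuous a x : creg a setT x -> {for x, continuous (cinv a)}.
Proof.
move=> ax; have := @sm_inv_cont _ _ hM a.
rewrite continuous_open_subspace; last exact: (@sm_img_open _ _ hM).
by move=> /(_ x); apply; rewrite inE.
Qed.

Lemma creg_open a U : open U -> open (creg a U).
Proof.
move=> oU; rewrite openE => x; rewrite cregE => -[ax Ux]; rewrite /interior.
have n1 := open_nbhs_nbhs (conj (@sm_img_open _ _ hM a) ax).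
have n2 := cinv_continuous ax (open_nbhs_nbhs (conj oU Ux)).
by apply: filterS2 n1 n2 => y; split.
Qed.

Lemma creg_ctrans a b U x : creg a (U `&` cdom b) x ->
  creg b (U `&` cdom a) (ctrans a b x).
Proof.
case=> p [ap [Up bp]] <-; rewrite /ctrans (sm_mapK hM) //.
by exists p.
Qed.

Lemma cinv_ctrans a b U x : creg a (U `&` cdom b) x ->
  cinv b (ctrans a b x) = cinv a x.
Proof.
by case=> p [ap [Up bp]] <-; rewrite /ctrans !(sm_mapK hM) // (sm_mapK hM).
Qed.

Lemma locally_constant_chart {A : Type} (n : M -> A) U a x :
  locally_constant U n -> creg a U x ->
  \forall y \near x, n (cinv a y) = n (cinv a x).
Proof.
move=> nU; rewrite cregE => -[ax Ux].
exact: (cinv_continuous ax (nU _ Ux)).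
Qed.

End Regions.

(** * Operations that preserve forms *)

Section FormsTheory.
Context {R : realType} {M : charted R} (hM : smooth_manifold M).
Implicit Types (U : set M) (a b : cix M) (w : rform M R) (n : M -> int).
Local Notation E := 'rV[R]_(cdim M).

Lemma dR_altsum w a x vs :
  dR w a x vs = altsum (fun v r => 'D_v (fun y => w a y r) x) vs.
Proof. by rewrite (altsumE 0). Qed.

Lemma wedge_shuffle p w w' a x vs :
  wedge p w w' a x vs = shuffle p (w a x) (w' a x) vs.
Proof. by rewrite shuffleE. Qed.

Lemma form_derivable k U w a x v (r : seq E) : open U -> is_form k U w ->
  creg a U x -> size r = k -> derivable (fun y => w a y r) x v.
Proof.
move=> oU fw ax sr.
exact: smooth_on_derivable (form_smooth fw (a := a) sr) ax.
Qed.

Lemma is_form_sub k U U' w : U `<=` U' -> is_form k U' w -> is_form k U w.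
Proof.
move=> UU' fw; have sub a := creg_sub (a := a) UU'; split.
- by move=> a vs sv; apply: smooth_on_sub (form_smooth fw (a := a) sv).
- by move=> a x /sub; apply: (form_multilinear fw).
- by move=> a x /sub; apply: (form_alternating fw).
- move=> a b x vs ax; apply: (form_compat fw).
  by apply: creg_sub ax => y [Uy by']; split=> //; exact: UU'.
Qed.

Lemma is_form0 k U : open U -> is_form k U (0 : rform M R).
Proof.
move=> oU; split=> //.
- by move=> a vs _; apply: smooth_on_cst; exact: creg_open.
- by move=> a x _ c u v s t _; rewrite /= addr0 scaler0.
Qed.

Lemma is_form_lin k U w w' (c : R) : open U -> is_form k U w -> is_form k U w' ->
  is_form k U (fun a x vs => c * w a x vs + w' a x vs).
Proof.
move=> oU fw fw'; split.
- move=> a vs sv; apply: smooth_on_lin; first exact: creg_open.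
    exact: (form_smooth fw sv).
  exact: (form_smooth fw' sv).
- move=> a x ax d u v s t st; rewrite (form_multilinear fw) //.
  by rewrite (form_multilinear fw') // !scale_mul; ring.
- move=> a x ax u s t r st; rewrite (form_alternating fw) //.
  by rewrite (form_alternating fw') // mulr0 addr0.
- move=> a b x vs ax sv; congr (_ * _ + _); first exact: (form_compat fw).
  exact: (form_compat fw').
Qed.

Lemma is_formD k U w w' : open U -> is_form k U w -> is_form k U w' ->
  is_form k U (w + w').
Proof.
move=> oU fw fw'; have := is_form_lin 1 oU fw fw'.
by congr is_form; apply/funext => a; apply/funext => x; apply/funext => vs;
  rewrite mul1r.
Qed.

Lemma is_formN k U w : open U -> is_form k U w -> is_form k U (- w).
Proof.
move=> oU fw; have := is_form_lin (-1) oU fw (is_form0 k oU).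
by congr is_form; apply/funext => a; apply/funext => x; apply/funext => vs;
  rewrite mulN1r addr0.
Qed.

Lemma is_form_wedge p q U w w' : open U -> is_form p U w -> is_form q U w' ->
  is_form (p + q) U (wedge p w w').
Proof.
move=> oU fw fw'; split.
- move=> a vs sv; have oA := creg_open (a := a) hM oU.
  apply: (@eq_smooth_on _ _ _ _ (fun x => shuffle p (w a x) (w' a x) vs)) => //.
    by move=> x _; rewrite wedge_shuffle.
  apply: smooth_on_shuffle => // r sr; first exact: (form_smooth fw sr).
  by apply: (form_smooth fw'); apply/eqP; rewrite -(eqn_add2r p) sr sv addnC.
- move=> a x ax; have := shuffle_multilinear (form_multilinear fw ax)
    (form_multilinear fw' ax).
  by congr multilinear; apply/funext => vs; rewrite wedge_shuffle.
- move=> a x ax; have := shuffle_alternating (form_multilinear fw ax)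
    (form_multilinear fw' ax) (form_alternating fw ax) (form_alternating fw' ax).
  by congr Defs.alternating; apply/funext => vs; rewrite wedge_shuffle.
- move=> a b x vs ax sv; rewrite !wedge_shuffle shuffle_map.
  apply: eq_shuffle => r sr; first exact: (form_compat fw).
  by apply: (form_compat fw') => //; apply/eqP; rewrite -(eqn_add2r p) sr sv addnC.
Qed.

Lemma is_form_scale k U n w : open U -> locally_constant U n ->
  is_form k U w -> is_form k U (scale_form n w).
Proof.
move=> oU nU fw; split.
- move=> a vs sv; have oA := creg_open (a := a) hM oU; apply: smooth_onM => //.
    apply: smooth_on_near_cst => // x ax.
    by apply: filterS (locally_constant_chart hM nU ax) => y ->.
  exact: (form_smooth fw sv).
- move=> a x ax c u v s t st; rewrite /scale_form (form_multilinear fw) //.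
  by rewrite !scale_mul; ring.
- by move=> a x ax u s t r st; rewrite /scale_form (form_alternating fw) // mulr0.
- move=> a b x vs ax sv; rewrite /scale_form (cinv_ctrans hM ax).
  by congr (_ * _); exact: (form_compat fw).
Qed.

(** The delicate clause is compatibility with charts. Differentiating the transformation rule of w
    gives the rule for dw plus terms with second derivatives of the transition map, and these cancel
    in the alternating sum. *)
Lemma is_form_dR k U w : open U -> is_form k U w -> is_form k.+1 U (dR w).
Proof.
move=> oU fw; have oA a := creg_open (a := a) hM oU.
have mD a x : creg a U x ->
    multilinear k.+1 (altsum (fun v r => 'D_v (fun y => w a y r) x)).
  move=> ax; apply: altsum_multilinear.
    move=> r sr c u v; apply: derive_lin.
    exact: smooth_on_differentiable (form_smooth fw (a := a) sr) ax.
  move=> v; apply: (derive_multilinear v (oA a) ax) => [y ay|r sr].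
    exact: (form_multilinear fw).
  exact: smooth_on_differentiable (form_smooth fw (a := a) sr) ax.
split.
- move=> a vs sv.
  apply: (@eq_smooth_on _ _ _ _
    (fun x => altsum (fun v r => 'D_v (fun y => w a y r) x) vs)) => //.
    by move=> x _; rewrite dR_altsum.
  apply: smooth_on_altsum => // v r sr; apply: smooth_on_derive.
  by apply: (form_smooth fw); move: sr; rewrite sv => -[].
- by move=> a x /mD; congr multilinear; apply/funext => vs; rewrite dR_altsum.
- move=> a x ax; have -> : dR w a x =
      altsum (fun v r => 'D_v (fun y => w a y r) x).
    by apply/funext => vs; rewrite dR_altsum.
  apply: alternating_of_adjacent; first exact: mD.
  apply: altsum_adjacent => v u s t st.
  (* With a repeated argument w vanishes on the whole open region, hence so do its derivatives. *)
  rewrite (open_near_derive v (oA a) ax (g := cst 0)) ?derive_cst // => y ay.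
  exact: adjacent_of_alternating (form_alternating fw ay) _ _ _ st.
- move=> a b x vs ax sv; have oUb : open (U `&` cdom b).
    by apply: openI => //; exact: (sm_dom_open hM).
  have oAb := creg_open (a := a) hM oUb.
  have bx := creg_sub (@subIsetl _ _ _) (creg_ctrans hM ax).
  have sphi : smooth_on (creg a (U `&` cdom b)) (ctrans a b).
    by apply: smooth_on_sub (@sm_trans _ _ hM a b); apply: creg_sub => y [].
  (* [B] collects the unwanted terms: the argument pushed forward from u is differentiated once more
     along v. Its symmetry in u and v makes the double alternating sum vanish. *)
  pose B v u s := w b (ctrans a b x) ('D_v ('D_u (ctrans a b)) x ::
    [seq 'D_u (ctrans a b) x | u <- s]).
  have B0 : altsum (fun v => altsum (B v)) vs = 0.
    apply: altsum_altsum => u v r _.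
    by rewrite /B (derive_comm_rV u v oAb sphi ax).
  rewrite !dR_altsum altsum_map.
  rewrite (@eq_altsum _ _ _ (fun v r =>
      'D_('D_v (ctrans a b) x) (fun z => w b z
        [seq 'D_u (ctrans a b) x | u <- r]) (ctrans a b x) +
      altsum (B v) r)); last first.
    move=> v r; rewrite sv => -[sr].
    rewrite (open_near_derive v oAb ax (g := fun y => w b (ctrans a b y)
      [seq 'D_u (ctrans a b) y | u <- r])); last first.
      by move=> y ay; apply: (form_compat fw).
    have [|||||_ ->] := @is_derive_slots _ _ _ _ (creg a (U `&` cdom b))
      (creg b U) (ctrans a b) (w b) (fun u y => 'D_u (ctrans a b) y) x v r
      oAb (oA b) ax.
    - by move=> y /(creg_ctrans hM); apply: creg_sub => z [].
    - exact: smooth_on_differentiable ax.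
    - move=> u; apply: smooth_on_derivable ax; exact: smooth_on_derive.
    - by move=> z bz; rewrite sr; exact: (form_multilinear fw).
    - move=> s ss; apply: (smooth_on_differentiable _ bx).
      by apply: (form_smooth fw); rewrite ss.
    rewrite slotsum_altsum // sr; first exact: (form_multilinear fw).
    exact: (form_alternating fw).
  by rewrite altsumD B0 addr0.
Qed.

End FormsTheory.

(** * Algebraic identities for d, the wedge product and integer scaling *)

Section FormIdentities.
Context {R : realType} {M : charted R} (hM : smooth_manifold M).
Implicit Types (U : set M) (a b : cix M) (w : rform M R) (n : M -> int).
Local Notation E := 'rV[R]_(cdim M).

Lemma rform_addE w w' a x vs : (w + w') a x vs = w a x vs + w' a x vs.
Proof. by []. Qed.

Lemma rform_oppE w a x vs : (- w) a x vs = - w a x vs.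
Proof. by []. Qed.

Lemma form_eq_trans k U w1 w2 w3 :
  form_eq k U w1 w2 -> form_eq k U w2 w3 -> form_eq k U w1 w3.
Proof. by move=> e1 e2 a x vs ax sv; rewrite e1 ?e2. Qed.

Lemma form_eq_dR k U w w' : open U -> form_eq k U w w' ->
  form_eq k.+1 U (dR w) (dR w').
Proof.
move=> oU ww a x vs ax sv; rewrite !dR_altsum; apply: eq_altsum => v r sr.
apply: (open_near_derive v (creg_open hM oU) ax) => y ay; apply: ww ay _.
by move: sr; rewrite sv => -[].
Qed.

Lemma form_eq_wedge p q U w w1 w' w1' :
  form_eq p U w w1 -> form_eq q U w' w1' ->
  form_eq (p + q) U (wedge p w w') (wedge p w1 w1').
Proof.
move=> e1 e2 a x vs ax sv; rewrite !wedge_shuffle; apply: eq_shuffle => r sr.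
  exact: e1.
by apply: e2 => //; apply/eqP; rewrite -(eqn_add2r p) sr sv addnC.
Qed.

Lemma dR0 : dR (0 : rform M R) = 0.
Proof.
apply/funext => a; apply/funext => x; apply/funext => vs.
by rewrite /dR big1 // => l _; rewrite derive_cst scaler0.
Qed.

Lemma dRD k U w w' : open U -> is_form k U w -> is_form k U w' ->
  form_eq k.+1 U (dR (w + w')) (dR w + dR w').
Proof.
move=> oU fw fw' a x vs ax sv.
rewrite [RHS]rform_addE !dR_altsum -altsumD.
apply: eq_altsum => v r; rewrite sv => -[sr].
by apply: deriveD; apply: form_derivable ax sr.
Qed.

Lemma dRN k U w : open U -> is_form k U w ->
  form_eq k.+1 U (dR (- w)) (- dR w).
Proof.
move=> oU fw a x vs ax sv.
rewrite [RHS]rform_oppE !dR_altsum -altsumN.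
apply: eq_altsum => v r; rewrite sv => -[sr].
by apply: deriveN; apply: form_derivable ax sr.
Qed.

Lemma dR_dR k U w : open U -> is_form k U w -> form_eq k.+2 U (dR (dR w)) 0.
Proof.
move=> oU fw a x vs ax sv; rewrite dR_altsum.
have oA := creg_open (a := a) hM oU.
transitivity (altsum (fun u => altsum (fun v r =>
    'D_u ('D_v (fun y => w a y r)) x)) vs).
  apply: eq_altsum => u r; rewrite sv => -[sr].
  rewrite (open_near_derive u oA ax (g := fun y =>
    altsum (fun v s => 'D_v (fun z => w a z s) y) r)); last first.
    by move=> y ay; rewrite dR_altsum.
  have [v s|_ ->//] := @is_derive_altsum _ _ _ (fun y v s =>
    'D_v (fun z => w a z s) y) x u r.
  rewrite sr => -[ss]; apply: (@smooth_on_derivable _ _ _ _ _ _ _ _ ax).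
  exact: smooth_on_derive (form_smooth fw ss).
apply: altsum_altsum => u v r; rewrite sv => -[sr].
exact: derive_comm oA (form_smooth fw sr) ax.
Qed.

Lemma dR_wedge_closed p q U w w' : open U -> is_form p U w -> is_form q U w' ->
  form_eq q.+1 U (dR w') 0 ->
  form_eq (p + q).+1 U (dR (wedge p w w')) (wedge p.+1 (dR w) w').
Proof.
move=> oU fw fw' cw' a x vs ax sv; rewrite dR_altsum wedge_shuffle.
have oA := creg_open (a := a) hM oU.
transitivity (altsum (fun v => shuffle p (fun r => 'D_v (fun y => w a y r) x)
    (w' a x)) vs +
  altsum (fun v => shuffle p (w a x) (fun r => 'D_v (fun y => w' a y r) x)) vs).
  rewrite -altsumD; apply: eq_altsum => v r; rewrite sv => -[sr].
  rewrite (open_near_derive v oA ax (g := fun y =>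
    shuffle p (w a y) (w' a y) r)); last by move=> y ay; rewrite wedge_shuffle.
  have [s ss|s ss|_ ->//] :=
    @is_derive_shuffle _ _ _ p (fun y => w a y) (fun y => w' a y) x v r.
    exact: form_derivable ax ss.
  have sq : size s = q by apply/eqP; rewrite -(eqn_add2r p) ss sr addnC.
  exact: form_derivable ax sq.
rewrite altsum_shufflel altsum_shuffler.
rewrite [X in _ + _ * X](_ : _ = 0) ?mulr0 ?addr0.
  by apply: eq_shuffle => r sr //; rewrite dR_altsum.
rewrite -(shuffle0r p (w a x) vs); apply: eq_shuffle => // r sr.
rewrite -dR_altsum; apply: cw' => //.
by apply/eqP; rewrite -(eqn_add2r p) sr sv addSn addnC.
Qed.

Lemma dR_scale k U n w : open U -> locally_constant U n -> is_form k U w ->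
  form_eq k.+1 U (dR (scale_form n w)) (scale_form n (dR w)).
Proof.
move=> oU nU fw a x vs ax sv; rewrite /scale_form !dR_altsum -altsumZ.
apply: eq_altsum => v r; rewrite sv => -[sr].
rewrite -[RHS]/(_ *: _) -deriveZ; last exact: form_derivable ax sr.
apply: near_eq_derive.
by apply: filterS (locally_constant_chart hM nU ax) => y ->.
Qed.

Lemma dR_int k U n : open U -> locally_constant U n ->
  form_eq k U (dR (int_form n)) 0.
Proof.
move=> oU nU a x vs ax sv; rewrite /dR big1 // => l _.
have -> : 'D_(nth 0 vs l) (fun y => int_form n a y (del l vs) : R) x = 0.
  rewrite -(derive_cst ((n (cinv a x))%:~R : R) x (nth 0 vs l)).
  apply: near_eq_derive.
  by apply: filterS (locally_constant_chart hM nU ax) => y; rewrite /int_form => ->.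
exact: scaler0.
Qed.

Lemma rform_ext (w w' : rform M R) : (forall a x vs, w a x vs = w' a x vs) ->
  w = w'.
Proof.
move=> e; apply/funext => a; apply/funext => x; apply/funext => vs; exact: e.
Qed.

Lemma wedgeDl p w1 w2 w : wedge p (w1 + w2) w = wedge p w1 w + wedge p w2 w.
Proof.
apply: rform_ext => a x vs; rewrite [RHS]rform_addE.
by rewrite !wedge_shuffle -shuffleDl.
Qed.

Lemma wedgeDr p w1 w2 w : wedge p w (w1 + w2) = wedge p w w1 + wedge p w w2.
Proof.
apply: rform_ext => a x vs; rewrite [RHS]rform_addE.
by rewrite !wedge_shuffle -shuffleDr.
Qed.

Lemma wedge0l p w : wedge p 0 w = 0.
Proof. by apply: (addrI (wedge p 0 w)); rewrite -wedgeDl !addr0. Qed.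

Lemma wedge0r p w : wedge p w 0 = 0.
Proof. by apply: (addrI (wedge p w 0)); rewrite -wedgeDr !addr0. Qed.

Lemma wedgeA p q w1 w2 w3 :
  wedge p w1 (wedge q w2 w3) = wedge (p + q) (wedge p w1 w2) w3.
Proof.
apply: rform_ext => a x vs; rewrite !wedge_shuffle.
transitivity (shuffle p (w1 a x) (shuffle q (w2 a x) (w3 a x)) vs).
  by apply: eq_shuffle => // r _; rewrite wedge_shuffle.
by rewrite shuffleA; apply: eq_shuffle => // r _; rewrite wedge_shuffle.
Qed.

Lemma wedge_int n w : wedge 0 (int_form n) w = scale_form n w.
Proof.
apply: rform_ext => a x vs; rewrite wedge_shuffle /int_form /scale_form.
elim: vs (w a x) => //= v vs IH g.
by rewrite add0r expr0 mul1r IH.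
Qed.

Lemma wedge_scalel p n w w' :
  wedge p (scale_form n w) w' = scale_form n (wedge p w w').
Proof.
by apply: rform_ext => a x vs; rewrite {2}/scale_form !wedge_shuffle -shuffleZl.
Qed.

Lemma scale_formDl n n' w : scale_form (n + n') w = scale_form n w + scale_form n' w.
Proof.
apply: rform_ext => a x vs; rewrite [RHS]rform_addE.
by rewrite /scale_form -mulrDl -intrD.
Qed.

Lemma scale_formDr n w w' : scale_form n (w + w') = scale_form n w + scale_form n w'.
Proof.
apply: rform_ext => a x vs; rewrite [RHS]rform_addE.
by rewrite /scale_form -mulrDr.
Qed.

Lemma scale_formA n n' w :
  scale_form n (scale_form n' w) = scale_form (fun x => n x * n' x) w.
Proof. by apply: rform_ext => a x vs; rewrite /scale_form mulrA intrM. Qed.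

Lemma scale_form0 n : scale_form n (0 : rform M R) = 0.
Proof. by apply: rform_ext => a x vs; rewrite /scale_form mulr0. Qed.

Lemma form_eq_scale k U n n' w w' : (forall x, U x -> n x = n' x) ->
  form_eq k U w w' -> form_eq k U (scale_form n w) (scale_form n' w').
Proof.
move=> nn ww a x vs ax sv; rewrite /scale_form ww //.
by have [_ /nn ->] := creg_cinv hM ax.
Qed.

End FormIdentities.

(** * Sections of the Deligne complex *)

Lemma mulrz_sign {V : zmodType} (x : V) n :
  x *~ (-1) ^+ n = if odd n then - x else x.
Proof. by rewrite -signr_odd; case: (odd n); rewrite ?mulrN1z ?mulr1z. Qed.

Section Sections.
Context {R : realType} {M : charted R} (hM : smooth_manifold M).
Context (U : set M) (oU : open U).
Implicit Types (s t : dsec M) (p q e : nat).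

Lemma dsec_eq_refl p e s : dsec_eq p e U s s.
Proof. by rewrite /dsec_eq; case: ifP. Qed.

Lemma dsec_eq_of_eq p e s t : s = t -> dsec_eq p e U s t.
Proof. by move=> ->; exact: dsec_eq_refl. Qed.

Lemma dsec_eq_sym p e s t : dsec_eq p e U s t -> dsec_eq p e U t s.
Proof.
rewrite /dsec_eq; case: ifP => _ st; first by move=> x Ux; rewrite st.
by move=> ep a x vs ax sv; rewrite st.
Qed.

Lemma dsec_eq_trans p e t s r :
  dsec_eq p e U s t -> dsec_eq p e U t r -> dsec_eq p e U s r.
Proof.
rewrite /dsec_eq; case: ifP => _ st tr; first by move=> x Ux; rewrite st ?tr.
by move=> ep a x vs ax sv; rewrite st ?tr.
Qed.

Lemma dsec_eqD p e s s' t t' : dsec_eq p e U s s' -> dsec_eq p e U t t' ->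
  dsec_eq p e U (s + t) (s' + t').
Proof.
rewrite /dsec_eq; case: ifP => _ ss tt.
  by move=> x Ux; congr (_ + _); [exact: ss|exact: tt].
by move=> ep a x vs ax sv; congr (_ + _); [exact: ss|exact: tt].
Qed.

Lemma dsec_eqN p e s s' : dsec_eq p e U s s' -> dsec_eq p e U (- s) (- s').
Proof.
rewrite /dsec_eq; case: ifP => _ ss.
  by move=> x Ux; congr (- _); exact: ss.
by move=> ep a x vs ax sv; congr (- _); exact: ss.
Qed.

Lemma dsec_eq_sign p e s s' n : dsec_eq p e U s s' ->
  dsec_eq p e U (s *~ (-1) ^+ n) (s' *~ (-1) ^+ n).
Proof. by rewrite !mulrz_sign; case: odd => //; exact: dsec_eqN. Qed.

Lemma dsec_eq_sum p e (J : Type) (r : seq J) (P : pred J) (F G : J -> dsec M) :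
  (forall l, P l -> dsec_eq p e U (F l) (G l)) ->
  dsec_eq p e U (\sum_(l <- r | P l) F l) (\sum_(l <- r | P l) G l).
Proof.
move=> FG; elim/big_rec2 : _ => [|l x y Pl xy]; first exact: dsec_eq_refl.
by apply: dsec_eqD => //; exact: FG.
Qed.

Lemma is_dsec0 p e : is_dsec p e U 0.
Proof.
rewrite /is_dsec; case: ifP => _; first by move=> x Ux; exact: nearW.
by move=> _; exact: is_form0.
Qed.

Lemma is_dsecD p e s t : is_dsec p e U s -> is_dsec p e U t ->
  is_dsec p e U (s + t).
Proof.
rewrite /is_dsec; case: ifP => _ ss st.
  by move=> x Ux; apply: filterS2 (ss x Ux) (st x Ux) => y e1 e2;
    congr (_ + _).
by move=> ep; apply: is_formD => //; [exact: ss|exact: st].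
Qed.

Lemma is_dsecN p e s : is_dsec p e U s -> is_dsec p e U (- s).
Proof.
rewrite /is_dsec; case: ifP => _ ss.
  by move=> x Ux; apply: filterS (ss x Ux) => y e1; congr (- _).
by move=> ep; apply: is_formN => //; exact: ss.
Qed.

Lemma is_dsec_sign p e s n : is_dsec p e U s -> is_dsec p e U (s *~ (-1) ^+ n).
Proof. by rewrite mulrz_sign; case: odd => //; exact: is_dsecN. Qed.

Lemma is_dsec_sum p e (J : Type) (r : seq J) (P : pred J) (F : J -> dsec M) :
  (forall l, P l -> is_dsec p e U (F l)) ->
  is_dsec p e U (\sum_(l <- r | P l) F l).
Proof.
by move=> dF; elim/big_ind : _ => //; [exact: is_dsec0|exact: is_dsecD].
Qed.

Lemma is_dsec_form p e s : is_dsec p e U s -> e != 0%N -> (e <= p)%N ->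
  is_form e.-1 U s.2.
Proof. by rewrite /is_dsec; case: ifP. Qed.

Lemma ddel0 p e : ddel p e (0 : dsec M) = 0.
Proof.
rewrite /ddel; case: ifP => // _; case: ifP => _; last by rewrite dR0.
by congr (_, _); apply: rform_ext => a x vs; rewrite /int_form.
Qed.

Lemma ddelD p e s t : is_dsec p e U s -> is_dsec p e U t ->
  dsec_eq p e.+1 U (ddel p e (s + t)) (ddel p e s + ddel p e t).
Proof.
move=> ds dt; rewrite /ddel; case: leqP => [_|ep].
  by rewrite addr0; exact: dsec_eq_refl.
rewrite /dsec_eq /=; case: eqP ds dt => [-> _ _ _|/eqP e0 ds dt _].
  by move=> a x vs ax sv; rewrite rform_addE /int_form -intrD.
rewrite -(prednK (n := e)) ?lt0n //.
by apply: dRD => //; [exact: is_dsec_form (ltnW ep)|exact: is_dsec_form (ltnW ep)].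
Qed.

Lemma ddelN p e s : is_dsec p e U s ->
  dsec_eq p e.+1 U (ddel p e (- s)) (- ddel p e s).
Proof.
move=> ds; rewrite /ddel; case: leqP => [_|ep].
  by rewrite oppr0; exact: dsec_eq_refl.
rewrite /dsec_eq /=; case: eqP ds => [-> _ _|/eqP e0 ds _].
  by move=> a x vs ax sv; rewrite rform_oppE /int_form -intrN.
rewrite -(prednK (n := e)) ?lt0n //.
by apply: dRN => //; exact: is_dsec_form (ltnW ep).
Qed.

Lemma ddel_sign p e s n : is_dsec p e U s ->
  dsec_eq p e.+1 U (ddel p e (s *~ (-1) ^+ n)) (ddel p e s *~ (-1) ^+ n).
Proof.
by rewrite !mulrz_sign; case: odd => ds; [exact: ddelN|exact: dsec_eq_refl].
Qed.

Lemma ddel_sum p e (J : Type) (r : seq J) (P : pred J) (F : J -> dsec M) :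
  (forall l, P l -> is_dsec p e U (F l)) ->
  dsec_eq p e.+1 U (ddel p e (\sum_(l <- r | P l) F l))
    (\sum_(l <- r | P l) ddel p e (F l)).
Proof.
(* Additivity of d holds for sections only, so the induction also carries the fact that partial sums
   are sections. *)
move=> dF; have [//] : dsec_eq p e.+1 U (ddel p e (\sum_(l <- r | P l) F l))
    (\sum_(l <- r | P l) ddel p e (F l)) /\
    is_dsec p e U (\sum_(l <- r | P l) F l).
elim/big_rec2 : _ => [|l x y Pl [xy dy]].
  by rewrite ddel0; split; [exact: dsec_eq_refl|exact: is_dsec0].
have dFl := dF l Pl; split; last exact: is_dsecD.
apply: dsec_eq_trans (ddelD dFl dy) _.
by apply: dsec_eqD => //; exact: dsec_eq_refl.
Qed.

Lemma under_formE e s : e != 0%N -> under_form e s = s.2.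
Proof. by rewrite /under_form; case: ifP. Qed.

Lemma dsec_pair0 (n : M -> int) (w : rform M R) :
  n = 0 -> w = 0 -> (n, w) = 0 :> dsec M.
Proof. by move=> -> ->. Qed.

Lemma db_prod0l p q e1 e2 t : db_prod p q e1 e2 (0 : dsec M) t = 0.
Proof.
rewrite /db_prod; case: ifP => // _; case: ifP => _.
  case: ifP => _; apply: dsec_pair0 => //.
    by apply/funext => x; rewrite mul0r.
  by apply: rform_ext => a x vs; rewrite /scale_form mul0r.
by case: ifP => // _; rewrite wedge0l.
Qed.

Lemma db_prodDl p q e1 e2 s s' t :
  db_prod p q e1 e2 (s + s') t = db_prod p q e1 e2 s t + db_prod p q e1 e2 s' t.
Proof.
rewrite /db_prod; case: ifP => _; first by rewrite addr0.
case: ifP => _; last by case: ifP => _; rewrite ?addr0 // wedgeDl.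
case: ifP => _; last by rewrite scale_formDl.
by congr (_, _); [apply/funext => x; exact: mulrDl|rewrite addr0].
Qed.

Lemma db_prodNl p q e1 e2 s t :
  db_prod p q e1 e2 (- s) t = - db_prod p q e1 e2 s t.
Proof.
by apply: (addrI (db_prod p q e1 e2 s t)); rewrite -db_prodDl !subrr db_prod0l.
Qed.

Lemma db_prod_signl p q e1 e2 s t n :
  db_prod p q e1 e2 (s *~ (-1) ^+ n) t = db_prod p q e1 e2 s t *~ (-1) ^+ n.
Proof. by rewrite !mulrz_sign; case: odd => //; rewrite db_prodNl. Qed.

Lemma db_prod_suml p q e1 e2 (J : Type) (r : seq J) (P : pred J)
    (F : J -> dsec M) t :
  db_prod p q e1 e2 (\sum_(l <- r | P l) F l) t =
  \sum_(l <- r | P l) db_prod p q e1 e2 (F l) t.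
Proof.
by elim/big_rec2 : _ => [|l x y _ <-]; rewrite ?db_prod0l ?db_prodDl.
Qed.

Lemma db_prod0r p q e1 e2 s : (0 < q)%N ->
  db_prod p q e1 e2 s (0 : dsec M) = 0.
Proof.
move=> q0; rewrite /db_prod; case: ifP => // _; case: ifP => _.
  case: ifP => _; apply: dsec_pair0 => //; last by rewrite scale_form0.
  by apply/funext => x; rewrite mulr0.
case: eqP => // ->; rewrite under_formE -?lt0n //.
by apply: dsec_pair0; rewrite // dR0 wedge0r.
Qed.

Lemma dsec_eq_db_prod p q e1 e2 s s' t t' : (0 < q)%N ->
  dsec_eq p e1 U s s' -> dsec_eq q e2 U t t' ->
  dsec_eq (p + q) (e1 + e2) U (db_prod p q e1 e2 s t) (db_prod p q e1 e2 s' t').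
Proof.
move=> q0; rewrite /db_prod; case: ltnP => [_ _ _|e1p /=].
  exact: dsec_eq_refl.
case: ltnP => [_ _ _|e2q]; first exact: dsec_eq_refl.
rewrite /dsec_eq; case: (eqVneq e1 0%N) => [->|e10] ss; rewrite ?add0n /=.
  case: (eqVneq e2 0%N) => [_|e20] /= tt; first by move=> x Ux; rewrite ss ?tt.
  by move=> _; apply: form_eq_scale => //; exact: tt.
rewrite addn_eq0 (negPf e10) /= => tt _.
case: (eqVneq e2 q) tt => [->|_] tt //; rewrite !under_formE -?lt0n //.
(* Deligne degree e carries forms of degree e - 1: s has form degree e1 - 1, and dt has form degree
   q, whence the form degree of the product. *)
have -> : (e1 + q).-1 = (e1.-1 + q)%N by rewrite -(prednK (n := e1)) ?lt0n.
apply: form_eq_wedge; first exact: ss.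
move: tt; rewrite gtn_eqF // => tt.
by rewrite -(prednK q0); apply: form_eq_dR => //; exact: tt.
Qed.

Lemma is_dsec_db_prod p q e1 e2 s t : (0 < q)%N ->
  is_dsec p e1 U s -> is_dsec q e2 U t ->
  is_dsec (p + q) (e1 + e2) U (db_prod p q e1 e2 s t).
Proof.
move=> q0; rewrite /db_prod; case: ltnP => [_ _ _|e1p /=]; first exact: is_dsec0.
case: ltnP => [_ _ _|e2q]; first exact: is_dsec0.
case: (eqVneq e1 0%N) => [->|e10] ds dt.
  rewrite add0n /=; case: (eqVneq e2 0%N) dt => [->|e20] dt.
    move=> x Ux /=; apply: filterS2 (ds x Ux) (dt x Ux) => y e e'.
    by congr (_ * _).
  rewrite /is_dsec (negPf e20) => _; apply: is_form_scale => //.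
  exact: is_dsec_form dt e20 e2q.
case: (eqVneq e2 q) dt => [->|_] dt; last exact: is_dsec0.
rewrite /is_dsec addn_eq0 (negPf e10) /= => _.
rewrite under_formE -?lt0n //.
have -> : (e1 + q).-1 = (e1.-1 + q)%N by rewrite -(prednK (n := e1)) ?lt0n.
apply: is_form_wedge => //; first exact: is_dsec_form ds e10 e1p.
rewrite -(prednK q0); apply: is_form_dR => //.
by apply: is_dsec_form dt _ _; rewrite // -lt0n.
Qed.

(** In contrast with [db_prodDl], this is no plain equality: the right factor is differentiated, and
    d is additive only on smooth forms over U. *)
Lemma db_prodDr p q e1 e2 s t t' : (0 < q)%N ->
  is_dsec q e2 U t -> is_dsec q e2 U t' ->
  dsec_eq (p + q) (e1 + e2) U (db_prod p q e1 e2 s (t + t'))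
    (db_prod p q e1 e2 s t + db_prod p q e1 e2 s t').
Proof.
move=> q0 dt dt'; rewrite /db_prod; case: ifP => [_|].
  by rewrite addr0; exact: dsec_eq_refl.
move=> /negbT; rewrite negb_or -!leqNgt => /andP[e1p e2q].
case: (eqVneq e1 0%N) => [_|e10].
  case: (eqVneq e2 0%N) => [_|e20].
    apply: dsec_eq_of_eq; congr (_, _); last by rewrite addr0.
    by apply/funext => x; rewrite /= mulrDr.
  by apply: dsec_eq_of_eq; congr (_, _); rewrite ?addr0 // -scale_formDr.
case: (eqVneq e2 q) dt dt' => [->|_] dt dt'; last first.
  by rewrite addr0; exact: dsec_eq_refl.
have qn0 : q != 0%N by rewrite -lt0n.
rewrite /dsec_eq addn_eq0 (negPf e10) /= => _; rewrite !under_formE //.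
have -> : (e1 + q).-1 = (e1.-1 + q)%N by rewrite -(prednK (n := e1)) ?lt0n.
rewrite -[X in form_eq _ _ _ X]wedgeDr; apply: form_eq_wedge => //.
rewrite -(prednK q0); apply: dRD => //; exact: is_dsec_form (leqnn _).
Qed.

Lemma db_prodNr p q e1 e2 s t : (0 < q)%N -> is_dsec q e2 U t ->
  dsec_eq (p + q) (e1 + e2) U (db_prod p q e1 e2 s (- t))
    (- db_prod p q e1 e2 s t).
Proof.
move=> q0 dt.
have := db_prodDr p e1 s q0 (is_dsecN dt) dt.
rewrite addrC subrr db_prod0r //.
move=> /(dsec_eqD (dsec_eq_refl _ _ (- db_prod p q e1 e2 s t))).
by rewrite addr0 addrA addrAC addNr add0r => /dsec_eq_sym.
Qed.

Lemma db_prod_signr p q e1 e2 s t n : (0 < q)%N -> is_dsec q e2 U t ->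
  dsec_eq (p + q) (e1 + e2) U (db_prod p q e1 e2 s (t *~ (-1) ^+ n))
    (db_prod p q e1 e2 s t *~ (-1) ^+ n).
Proof.
move=> q0 dt; rewrite !mulrz_sign.
by case: odd; [exact: db_prodNr|exact: dsec_eq_refl].
Qed.

Lemma db_prod_sumr p q e1 e2 s (J : Type) (r : seq J) (P : pred J)
    (F : J -> dsec M) : (0 < q)%N ->
  (forall l, P l -> is_dsec q e2 U (F l)) ->
  dsec_eq (p + q) (e1 + e2) U (db_prod p q e1 e2 s (\sum_(l <- r | P l) F l))
    (\sum_(l <- r | P l) db_prod p q e1 e2 s (F l)).
Proof.
move=> q0 dF.
have [//] : dsec_eq (p + q) (e1 + e2) U
      (db_prod p q e1 e2 s (\sum_(l <- r | P l) F l))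
    (\sum_(l <- r | P l) db_prod p q e1 e2 s (F l)) /\
    is_dsec q e2 U (\sum_(l <- r | P l) F l).
elim/big_rec2 : _ => [|l x y Pl [xy dy]].
  by rewrite db_prod0r //; split; [exact: dsec_eq_refl|exact: is_dsec0].
have dFl := dF l Pl; split; last exact: is_dsecD.
apply: dsec_eq_trans (db_prodDr p e1 s q0 dFl dy) _.
by apply: dsec_eqD => //; exact: dsec_eq_refl.
Qed.

End Sections.

(** * Leibniz rule and associativity for local sections *)

Section Product.
Context {R : realType} {M : charted R} (hM : smooth_manifold M).
Context (U : set M) (oU : open U).
Implicit Types (s t : dsec M) (p q e : nat).

Lemma dsec_eqS p e s t : dsec_eq p e.+1 U s t =
  ((e < p)%N -> form_eq e U s.2 t.2).
Proof. by []. Qed.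

Lemma db_prod_big p q e1 e2 s t : (p < e1)%N || (q < e2)%N ->
  db_prod p q e1 e2 s t = 0.
Proof. by rewrite /db_prod => ->. Qed.

Lemma db_prod00 p q s t :
  db_prod p q 0 0 s t = (fun x => s.1 x * t.1 x, 0).
Proof. by []. Qed.

Lemma db_prod0S p q e s t : (e <= q)%N -> e != 0%N ->
  db_prod p q 0 e s t = (0, scale_form s.1 t.2).
Proof. by rewrite /db_prod leqNgt /= => /negPf-> /negPf->. Qed.

Lemma db_prod_top p q e s t : (e <= p)%N -> e != 0%N -> q != 0%N ->
  db_prod p q e q s t = (0, wedge e.-1 s.2 (dR t.2)).
Proof.
by move=> ep e0 q0; rewrite /db_prod ltnNge ep ltnn (negPf e0) eqxx under_formE.
Qed.

Lemma db_prod_mid p q e1 e2 s t : e1 != 0%N -> e2 != q ->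
  db_prod p q e1 e2 s t = 0.
Proof. by move=> e10 e2q; rewrite /db_prod (negPf e10) (negPf e2q) if_same. Qed.

Lemma ddel_big p e s : (p <= e)%N -> ddel p e s = 0.
Proof. by rewrite /ddel => ->. Qed.

Lemma ddel_int p s : (0 < p)%N -> ddel p 0 s = (0, int_form s.1).
Proof. by case: p. Qed.

Lemma ddel_form p e s : (e < p)%N -> e != 0%N -> ddel p e s = (0, dR s.2).
Proof. by move=> ep e0; rewrite /ddel leqNgt ep (negPf e0). Qed.

Lemma ddel_closed p e s : is_dsec p e U s -> (e < p)%N ->
  form_eq e.+1 U (dR (ddel p e s).2) 0.
Proof.
move=> ds ep; case: (eqVneq e 0%N) ds => [->|e0] ds.
  by rewrite ddel_int ?(leq_trans _ ep) //; exact: dR_int.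
rewrite ddel_form //= -(prednK (n := e)) ?lt0n //.
apply: (dR_dR hM oU); exact: is_dsec_form ds e0 (ltnW ep).
Qed.

(** Since q is positive, t cannot be both an integer (e2 = 0) and of top degree (e2 = q). In each
    range of degrees at most one of the two terms on the right survives: the first one for e2 = q,
    the second one for e1 = 0 and e2 < q. *)
Lemma ddel_db_prod p q e1 e2 s t : (0 < p)%N -> (0 < q)%N ->
  is_dsec p e1 U s -> is_dsec q e2 U t ->
  dsec_eq (p + q) (e1 + e2).+1 U (ddel (p + q) (e1 + e2) (db_prod p q e1 e2 s t))
    (db_prod p q e1.+1 e2 (ddel p e1 s) t +
     db_prod p q e1 e2.+1 s (ddel q e2 t) *~ (-1) ^+ e1).
Proof.
move=> p0 q0 ds dt; have qn0 : q != 0%N by rewrite -lt0n.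
case: (ltnP p e1) => [pe1|e1p].
  have z e e' (s' t' : dsec M) : (e1 <= e)%N -> db_prod p q e e' s' t' = 0.
    by move=> ee; rewrite db_prod_big // (leq_trans pe1).
  by rewrite !z // ddel0 mul0rz addr0; exact: dsec_eq_refl.
case: (ltnP q e2) => [qe2|e2q].
  have z e e' (s' t' : dsec M) : (e2 <= e')%N -> db_prod p q e e' s' t' = 0.
    by move=> ee; rewrite db_prod_big // (leq_trans qe2) ?orbT.
  by rewrite !z // ddel0 mul0rz addr0; exact: dsec_eq_refl.
case: (eqVneq e1 0%N) ds e1p => [->|e10] ds e1p.
  rewrite expr0 mulr1z add0n.
  case: (eqVneq e2 0%N) dt e2q => [->|e20] dt e2q.
    rewrite db_prod00 !ddel_int ?addn_gt0 ?p0 // db_prod_mid 1?eq_sym //.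
    rewrite db_prod0S // add0r dsec_eqS => _ a x vs ax sv.
    by rewrite /= /int_form /scale_form intrM.
  rewrite db_prod0S // ddel_form //; last exact: leq_trans (leq_add p0 e2q).
  have ft := is_dsec_form dt e20 e2q.
  rewrite dsec_eqS => _; rewrite ddel_int // -{1}(prednK (n := e2)) ?lt0n //.
  apply: form_eq_trans (dR_scale hM oU ds ft) _.
  (* For e2 = q the surviving term is the first: ddel turns the integer s into a 0-form, whose wedge
     with dt is the scaling of dt by s. Below q the second term gives the same scaling directly. *)
  case: (eqVneq e2 q) => [->|e2nq].
    rewrite db_prod_top // db_prod_big ?ltnSn ?orbT // addr0 /= wedge_int.
    by move=> a x vs _ _.
  have e2q' : (e2 < q)%N by rewrite ltn_neqAle e2nq.
  rewrite db_prod_mid // db_prod0S // ddel_form // add0r.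
  by move=> a x vs _ _.
have fs := is_dsec_form ds e10 e1p.
case: (eqVneq e2 q) dt => [->|e2nq] dt.
  rewrite [X in _ + X *~ _]db_prod_big ?ltnSn ?orbT // mul0rz addr0.
  (* At e1 = p the product has the top degree p + q, so both sides are cut off by the truncation. *)
  case: (ltnP e1 p) => [e1p'|pe1]; last first.
    by rewrite ddel_big ?leq_add2r // db_prod_big ?ltnS ?pe1.
  rewrite db_prod_top // ddel_form ?ltn_add2r ?addn_eq0 ?negb_and ?e10 //.
  rewrite db_prod_top // dsec_eqS => _ /=; rewrite ddel_form //=.
  have ft := is_dsec_form dt qn0 (leqnn q).
  have -> : (e1 + q)%N = (e1.-1 + q).+1 by rewrite -addSn prednK ?lt0n.
  have := dR_wedge_closed hM oU fs (is_form_dR hM oU ft).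
  rewrite !prednK ?lt0n //; apply.
  have := dR_dR hM oU ft; by rewrite prednK.
have e2q' : (e2 < q)%N by rewrite ltn_neqAle e2nq.
rewrite db_prod_mid // ddel0 [X in X + _]db_prod_mid // add0r.
(* Just below the top the product is 0 while x u dt is formally present; it equals s /\ d(dt), and
   [ddel_closed] makes it vanish, also when t is an integer (q = 1). *)
case: (eqVneq e2.+1 q) => [e2q1|e2q1]; last first.
  by rewrite db_prod_mid // mul0rz; exact: dsec_eq_refl.
rewrite -[X in dsec_eq _ _ _ X](mul0rz _ ((-1) ^+ e1)); apply: dsec_eq_sign.
rewrite -{2}e2q1 e2q1 db_prod_top // dsec_eqS => _ a x vs ax sv /=.
rewrite [RHS](form_eq_wedge (p := e1.-1) (q := e2.+1) (w1 := s.2) (w1' := 0) _ _ ax).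
- by rewrite wedge0r.
- by [].
- exact: ddel_closed.
- by rewrite sv addnS -addSn prednK ?lt0n.
Qed.

(** For e1 > 0 both sides vanish unless t and u have top degree; then (s /\ dt) /\ du is compared
    with s /\ d(t /\ du). For e1 = 0 an integer is pulled out of the remaining product. *)
Lemma db_prodA p1 p2 p3 e1 e2 e3 s t u : (0 < p2)%N -> (0 < p3)%N ->
  is_dsec p2 e2 U t -> is_dsec p3 e3 U u ->
  dsec_eq (p1 + p2 + p3) (e1 + e2 + e3) U
    (db_prod (p1 + p2) p3 (e1 + e2) e3 (db_prod p1 p2 e1 e2 s t) u)
    (db_prod p1 (p2 + p3) e1 (e2 + e3) s (db_prod p2 p3 e2 e3 t u)).
Proof.
move=> p20 p30 dt du.
have p23 : (0 < p2 + p3)%N by rewrite addn_gt0 p20.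
have n3 : p3 != 0%N by rewrite -lt0n.
have n2 : p2 != 0%N by rewrite -lt0n.
case: (ltnP p1 e1) => [h|h1].
  by rewrite !(@db_prod_big p1) ?h // db_prod0l; exact: dsec_eq_refl.
case: (ltnP p2 e2) => [h|h2].
  rewrite (@db_prod_big p1) ?h ?orbT // db_prod0l.
  by rewrite (@db_prod_big p2) ?h // db_prod0r //; exact: dsec_eq_refl.
case: (ltnP p3 e3) => [h|h3].
  rewrite db_prod_big ?h ?orbT //.
  by rewrite (@db_prod_big p2) ?h ?orbT // db_prod0r //; exact: dsec_eq_refl.
case: (eqVneq e1 0%N) h1 => [->|e10] h1.
  rewrite !add0n; case: (eqVneq e2 0%N) h2 {dt} => [->|e20] h2.
    rewrite add0n !db_prod00; case: (eqVneq e3 0%N) h3 {du} => [->|e30] h3.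
      rewrite !db_prod00; apply: dsec_eq_of_eq; congr (_, _).
      by apply/funext => x; rewrite /= mulrA.
    rewrite !db_prod0S //; last by apply: leq_trans h3 _; exact: leq_addl.
    by apply: dsec_eq_of_eq; congr (_, _); rewrite /= scale_formA.
  rewrite db_prod0S // (@db_prod0S p1) ?addn_eq0 ?negb_and ?e20 ?leq_add //.
  apply: dsec_eq_of_eq.
  case: (eqVneq e3 p3) => [->|e3n].
    rewrite !db_prod_top //; first by rewrite /= wedge_scalel.
    by apply: leq_trans h2 _; exact: leq_addl.
  by rewrite !db_prod_mid //= scale_form0.
have e120 : (e1 + e2)%N != 0%N by rewrite addn_eq0 negb_and e10.
case: (eqVneq e3 p3) du => [->|e3n] du; last first.
  (* The right side vanishes as well. If t is an integer, the inner product has degree e3 <= p3 < p2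
     + p3, short of the top; otherwise the inner product is already 0. *)
  rewrite db_prod_mid //; case: (eqVneq e2 0%N) h2 {dt} => [->|e20] h2.
    rewrite [X in dsec_eq _ _ _ _ X]db_prod_mid; first exact: dsec_eq_refl.
      by [].
    by rewrite add0n neq_ltn (leq_ltn_trans h3) // -{1}(add0n p3) ltn_add2r.
  by rewrite (@db_prod_mid p2) // db_prod0r //; exact: dsec_eq_refl.
case: (eqVneq e2 p2) dt => [->|e2n] dt; last first.
  rewrite (@db_prod_mid p1) // db_prod0l db_prod_mid ?eqn_add2r //.
  exact: dsec_eq_refl.
rewrite !db_prod_top ?leq_add // -?lt0n ?addn_gt0 ?p20 ?orbT //.
rewrite /dsec_eq !addn_eq0 (negPf e10) /= => _.
have e12 : (e1 + p2).-1 = (e1.-1 + p2)%N by rewrite -(prednK (n := e1)) ?lt0n.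
have -> : (e1 + p2 + p3).-1 = (e1.-1 + (p2 + p3))%N.
  by rewrite -addnA -(prednK (n := e1)) ?lt0n.
rewrite e12 -wedgeA; apply: form_eq_wedge => //.
have ft := is_dsec_form dt n2 (leqnn _).
have fu := is_dsec_form du n3 (leqnn _).
have := dR_wedge_closed hM oU ft (is_form_dR hM oU fu) (dR_dR hM oU fu).
rewrite !prednK // -addSn prednK // => h a x vs ax sv.
by rewrite h.
Qed.

End Product.

(** * Cech-Deligne cochains *)

Section Faces.
Context {T : Type}.
Implicit Types (s : seq T).

Lemma size_del l s n : size s = n.+1 -> (l < n.+1)%N -> size (del l s) = n.
Proof.
move=> sn ln; rewrite size_cat size_drop size_take sn ln subSS subnKC //.
Qed.

Lemma take_del_le c l s : (l <= c)%N ->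
  take c.+1 (del l s) = del l (take c.+2 s).
Proof.
elim: l c s => [|l IH] [|c] [|a s] //= lc; rewrite /del /= ?drop0 ?take0 //.
by congr cons; exact: (IH c s).
Qed.

Lemma drop_del_le c l s : (l <= c)%N -> drop c (del l s) = drop c.+1 s.
Proof.
elim: l c s => [|l IH] c [|a s] //= lc; rewrite /del /= ?drop0 //.
by case: c lc => // c lc; exact: (IH c s).
Qed.

Lemma take_del_gt c l s : (c <= l)%N -> take c (del l s) = take c s.
Proof.
elim: c l s => [|c IH] [|l] [|a s] //=; rewrite ?take0 // => cl.
by congr cons; exact: IH.
Qed.

Lemma drop_del_ge c l s : drop c (del (c + l) s) = del l (drop c s).
Proof.
elim: c s => [|c IH] [|a s]; rewrite ?drop0 //.
exact: IH.
Qed.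

(* The faces of a simplex fall on one side of the vertex c of the split; the two
   sums on the right share the extra faces l = c + 1 and l = 0, with opposite
   signs. *)
Lemma faces_split {A : zmodType} (b : seq T -> seq T -> A) c n s :
  size s = n.+1 -> (c < n)%N ->
  \sum_(l < n.+1) b (take c.+1 (del l s)) (drop c (del l s)) *~ (-1) ^+ l =
  \sum_(l < c.+2) b (del l (take c.+2 s)) (drop c.+1 s) *~ (-1) ^+ l +
  \sum_(l < (n - c).+1) b (take c.+1 s) (del l (drop c s)) *~ (-1) ^+ (l + c).
Proof.
move=> sn cn.
rewrite -(big_mkord xpredT (fun l =>
  b (take c.+1 (del l s)) (drop c (del l s)) *~ (-1) ^+ l)).
rewrite (big_cat_nat (n := c.+1)) //=; last by rewrite ltnW // ltnS.
rewrite big_ord_recr /= [X in _ = _ + X]big_ord_recl /=.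
have -> : del c.+1 (take c.+2 s) = take c.+1 s.
  by rewrite /del take_takel // drop_oversize ?cats0 // size_take; case: ifP; lia.
have -> : del 0 (drop c s) = drop c.+1 s.
  by rewrite /del take0 drop_drop add1n.
rewrite addrA -[X in _ = X + _]addrA add0n -mulrzDr exprS mulN1r addNr mulr0z addr0.
rewrite -(big_mkord xpredT (fun l =>
  b (del l (take c.+2 s)) (drop c.+1 s) *~ (-1) ^+ l)).
congr (_ + _).
  apply: eq_big_nat => l /andP[_ lc].
  by rewrite take_del_le // drop_del_le.
rewrite -{1}(add0n c.+1) big_addn.
rewrite (_ : (n.+1 - c.+1 = n - c)%N) //.
rewrite big_mkord; apply: eq_bigr => l _.
rewrite /bump leq0n add1n addSn -addnS take_del_gt; last by lia.
by rewrite -drop_del_ge addnS -addSn addnC.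
Qed.

End Faces.

Section Cech.
Context {R : realType} {M : charted R} (hM : smooth_manifold M).
Context {I : Type} (U : I -> set M) (oU : forall a, open (U a)).
Implicit Types (s t : seq I) (x y : seq I -> dsec M) (r p q : nat).

Lemma inter_open s : open (inter U s).
Proof.
by rewrite /inter; elim/big_ind : _ => //; [exact: openT|exact: openI].
Qed.

Lemma inter_take n s : inter U s `<=` inter U (take n s).
Proof. by move=> z; rewrite -{1}(cat_take_drop n s) /inter big_cat => -[]. Qed.

Lemma inter_drop n s : inter U s `<=` inter U (drop n s).
Proof. by move=> z; rewrite -{1}(cat_take_drop n s) /inter big_cat => -[]. Qed.

Lemma inter_del l s : inter U s `<=` inter U (del l s).
Proof.
move=> z Uz; rewrite /inter big_cat /=.
by split; [exact: inter_take|exact: inter_drop].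
Qed.

Lemma is_dsec_sub (V V' : set M) p e (u : dsec M) : V `<=` V' ->
  is_dsec p e V' u -> is_dsec p e V u.
Proof.
move=> VV; rewrite /is_dsec; case: ifP => _ du; first by move=> z /VV; apply: du.
by move=> ep; apply: is_form_sub VV (du ep).
Qed.

Lemma dsec_eq_sub (V V' : set M) p e (u v : dsec M) : V `<=` V' ->
  dsec_eq p e V' u v -> dsec_eq p e V u v.
Proof.
move=> VV; rewrite /dsec_eq; case: ifP => _ du; first by move=> z /VV; apply: du.
by move=> ep a z vs /(creg_sub VV) az; apply: du.
Qed.

Lemma cochain_dsec r p x s t c : @is_cochain _ _ _ U r p x ->
  inter U s `<=` inter U t -> size t = c.+1 -> (c <= r)%N ->
  is_dsec p (r - c) (inter U s) (x t).
Proof.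
move=> cx st tc cr; apply: is_dsec_sub st _.
by have := cx t; rewrite tc subSS; apply; rewrite /= ltnS.
Qed.

Lemma cochain_dsec_eq r p x y s t c : @cochain_eq _ _ _ U r p x y ->
  inter U s `<=` inter U t -> size t = c.+1 -> (c <= r)%N ->
  dsec_eq p (r - c) (inter U s) (x t) (y t).
Proof.
move=> cx st tc cr; apply: dsec_eq_sub st _.
by have := cx t; rewrite tc subSS; apply; rewrite /= ltnS.
Qed.

Lemma cochain_eq_sym r p x y :
  @cochain_eq _ _ _ U r p x y -> @cochain_eq _ _ _ U r p y x.
Proof. by move=> xy s /xy; exact: dsec_eq_sym. Qed.

Lemma cochain_eq_trans r p x y z : @cochain_eq _ _ _ U r p x y ->
  @cochain_eq _ _ _ U r p y z -> @cochain_eq _ _ _ U r p x z.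
Proof. by move=> xy yz s sr; apply: dsec_eq_trans (xy s sr) (yz s sr). Qed.

Lemma cochain_eq_refl r p x : @cochain_eq _ _ _ U r p x x.
Proof. by move=> s _; exact: dsec_eq_refl. Qed.

Lemma cochain_eqD r p x x' y y' : @cochain_eq _ _ _ U r p x x' ->
  @cochain_eq _ _ _ U r p y y' -> @cochain_eq _ _ _ U r p (x + y) (x' + y').
Proof. by move=> xx yy s sr; apply: dsec_eqD; [exact: xx|exact: yy]. Qed.

Lemma cochain_signE x n s : (x *~ (-1) ^+ n) s = x s *~ (-1) ^+ n.
Proof. by rewrite !mulrz_sign; case: odd. Qed.

Lemma cochain_eq_sign r p x x' n : @cochain_eq _ _ _ U r p x x' ->
  @cochain_eq _ _ _ U r p (x *~ (-1) ^+ n) (x' *~ (-1) ^+ n).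
Proof.
by move=> xx s sr; rewrite !cochain_signE; apply: dsec_eq_sign; exact: xx.
Qed.

Lemma is_cochainD r p x y : @is_cochain _ _ _ U r p x ->
  @is_cochain _ _ _ U r p y -> @is_cochain _ _ _ U r p (x + y).
Proof.
move=> cx cy s sr; apply: (is_dsecD hM (inter_open s)) => //; [exact: cx|exact: cy].
Qed.

Lemma is_cochain_sign r p x n : @is_cochain _ _ _ U r p x ->
  @is_cochain _ _ _ U r p (x *~ (-1) ^+ n).
Proof.
move=> cx s sr; rewrite cochain_signE.
by apply: (is_dsec_sign hM (inter_open s)); exact: cx.
Qed.

Lemma is_cochain0 r p : @is_cochain _ _ _ U r p 0.
Proof. by move=> s _; exact: (is_dsec0 hM (inter_open s)). Qed.

Lemma cech_deltaD r p x y s : @cech_delta R M I r p (x + y) s =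
  @cech_delta R M I r p x s + @cech_delta R M I r p y s.
Proof.
rewrite /cech_delta -big_split; apply: eq_bigr => l _ /=.
by rewrite -mulrzDl.
Qed.

Lemma cech_delta_sign r p x s n : @cech_delta R M I r p (x *~ (-1) ^+ n) s =
  @cech_delta R M I r p x s *~ (-1) ^+ n.
Proof.
rewrite /cech_delta mulrz_suml; apply: eq_bigr => l _.
by rewrite cochain_signE -!mulrzA mulrC.
Qed.

(** Matching on the Deligne degree e and the Cech dimension n makes the boundary cases compute: no d
    arrives in degree 0, and no delta on a vertex. *)
Lemma DE r p x s n e : size s = n.+1 -> (n <= r.+1)%N -> e = (r.+1 - n)%N ->
  @D R M I r p x s = (if e is e'.+1 then ddel p e' (x s) else 0) +
    (if n is 0 then 0 else @cech_delta R M I r p x s *~ (-1) ^+ e).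
Proof.
move=> sn nr ->; rewrite /D sn subSS; congr (_ + _).
  by case: (r.+1 - n)%N.
by case: n {nr} sn.
Qed.

Lemma size_face s n r : (0 < size s <= r.+2)%N -> size s = n.+1 ->
  (n <= r.+1)%N.
Proof. by move=> /andP[_ sr] sn; rewrite sn in sr. Qed.

Lemma D_add r p x y : @is_cochain _ _ _ U r p x -> @is_cochain _ _ _ U r p y ->
  @cochain_eq _ _ _ U r.+1 p (@D _ _ _ r p (x + y))
    ((@D _ _ _ r p x : seq I -> dsec M) + @D _ _ _ r p y).
Proof.
move=> cx cy s /[dup] s0 /andP[+ _]; case sn : (size s) => [//|n] _.
have nr := size_face s0 sn.
rewrite -[X in dsec_eq _ _ _ _ X]/(D x s + D y s).
rewrite !(@DE _ _ _ _ _ _ sn nr erefl) subSS addrACA; apply: dsec_eqD; last first.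
  apply: dsec_eq_of_eq; case: (n) => [|n']; first by rewrite addr0.
  by rewrite cech_deltaD mulrzDl.
case en : (r.+1 - n)%N => [|e]; first by rewrite addr0; exact: dsec_eq_refl.
have er : e = (r - n)%N by lia.
have nr' : (n <= r)%N by lia.
apply: (ddelD (inter_open s)); rewrite er.
  exact: cochain_dsec cx _ sn nr'.
exact: cochain_dsec cy _ sn nr'.
Qed.

Lemma D_sign r p x n : @is_cochain _ _ _ U r p x ->
  @cochain_eq _ _ _ U r.+1 p (@D _ _ _ r p (x *~ (-1) ^+ n))
    ((@D _ _ _ r p x : seq I -> dsec M) *~ (-1) ^+ n).
Proof.
move=> cx s /[dup] s0 /andP[+ _]; case sn : (size s) => [//|m] _.
have nr := size_face s0 sn.
rewrite cochain_signE !(@DE _ _ _ _ _ _ sn nr erefl) subSS mulrzDl.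
apply: dsec_eqD; last first.
  apply: dsec_eq_of_eq; case: (m) => [|m']; first by rewrite mul0rz.
  by rewrite cech_delta_sign -!mulrzA mulrC.
case em : (r.+1 - m)%N => [|e]; first by rewrite mul0rz; exact: dsec_eq_refl.
have er : e = (r - m)%N by lia.
have mr' : (m <= r)%N by lia.
rewrite cochain_signE; apply: (ddel_sign (inter_open s)); rewrite er.
exact: cochain_dsec cx _ sn mr'.
Qed.

Lemma D_0 r p : @D R M I r p 0 = 0 :> (seq I -> dsec M).
Proof.
apply/funext => s; rewrite /D ddel0 if_same add0r; case: ifP => // _.
rewrite /cech_delta big1 ?mul0rz // => l _; exact: mul0rz.
Qed.

Lemma coboundary0 r p : @coboundary _ _ _ U r p 0.
Proof.
case: r => [|r]; first exact: cochain_eq_refl.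
by exists 0; [exact: is_cochain0|rewrite D_0; exact: cochain_eq_refl].
Qed.

Lemma coboundaryD r p x y : @coboundary _ _ _ U r p x ->
  @coboundary _ _ _ U r p y -> @coboundary _ _ _ U r p (x + y).
Proof.
case: r => [|r].
  by move=> cx cy; have := cochain_eqD cx cy; rewrite addr0.
move=> [w cw xw] [v cv yv]; exists (w + v); first exact: is_cochainD.
exact: cochain_eq_trans (cochain_eqD xw yv) (cochain_eq_sym (D_add cw cv)).
Qed.

Lemma coh_class_refl r p x : @cocycle _ _ _ U r p x -> @coh_class _ _ _ U r p x x.
Proof. by move=> cx; split=> //; rewrite subrr; exact: coboundary0. Qed.

Lemma coh_class_trans r p x y z : @coh_class _ _ _ U r p x y ->
  @coh_class _ _ _ U r p y z -> @coh_class _ _ _ U r p x z.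
Proof.
move=> [cy yx] [cz zy]; split=> //.
by have := coboundaryD zy yx; rewrite addrA subrK.
Qed.

End Cech.

(** * The cup product *)

(** Pairs of cuts a <= b of a simplex, indexed by the outer cut b for one bracketing of a triple
    product and by a and the gap m for the other. *)
Lemma triangle_sum {A : nmodType} (L : nat -> nat -> A) n :
  \sum_(b < n.+1) \sum_(a < b.+1) L a b =
  \sum_(a < n.+1) \sum_(m < (n - a).+1) L a (a + m)%N.
Proof.
elim: n => [|n IH]; first by rewrite !big_ord1.
rewrite big_ord_recr IH [RHS]big_ord_recr /= subnn big_ord1 addn0.
rewrite [X in _ + X]big_ord_recr addrA -big_split; congr (_ + _).
apply: eq_bigr => a _ /=; have an := ltn_ord a.
by rewrite subSn // [RHS]big_ord_recr /= addnS subnKC.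
Qed.

Lemma mulrz_parity {V : zmodType} (x : V) m n : odd m = odd n ->
  x *~ (-1) ^+ m = x *~ (-1) ^+ n.
Proof. by rewrite !mulrz_sign => ->. Qed.

Lemma mulrz_signD {V : zmodType} (x : V) m n :
  x *~ (-1) ^+ m *~ (-1) ^+ n = x *~ (-1) ^+ (m + n).
Proof. by rewrite -mulrzA exprD. Qed.

Section Cup.
Context {R : realType} {M : charted R} (hM : smooth_manifold M).
Context {I : Type} (U : I -> set M) (oU : forall a, open (U a)).
Implicit Types (s t : seq I) (x y z : seq I -> dsec M) (r p q : nat).

Lemma cupE r1 p r2 q x y s n : size s = n.+1 ->
  @cup R M I r1 p r2 q x y s = \sum_(c < n.+1)
    if (c <= r1)%N && (n - c <= r2)%N then
      db_prod p q (r1 - c) (r2 - (n - c)) (x (take c.+1 s)) (y (drop c s))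
        *~ (-1) ^+ (c * (r2 - (n - c)))
    else 0.
Proof. by rewrite /cup => ->. Qed.

Lemma size_take_face s n c : size s = n.+1 -> (c < n.+1)%N ->
  size (take c.+1 s) = c.+1.
Proof. by move=> sn cn; rewrite size_takel // sn. Qed.

Lemma size_drop_face s n c : size s = n.+1 -> (c < n.+1)%N ->
  size (drop c s) = (n - c).+1.
Proof. by move=> sn cn; rewrite size_drop sn subSn. Qed.

Lemma is_cochain_cup r1 p r2 q x y : (0 < q)%N ->
  @is_cochain _ _ _ U r1 p x -> @is_cochain _ _ _ U r2 q y ->
  @is_cochain _ _ _ U (r1 + r2) (p + q) (@cup R M I r1 p r2 q x y).
Proof.
move=> q0 cx cy s /andP[+ _]; case sn : (size s) => [//|n] _.
rewrite (cupE _ _ _ _ _ _ sn) subSS; apply: (is_dsec_sum hM (inter_open oU s)).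
move=> c _; have cn := ltn_ord c.
case: ifP => [/andP[c1 c2]|_]; last exact: (is_dsec0 hM (inter_open oU s)).
have -> : (r1 + r2 - n)%N = (r1 - c + (r2 - (n - c)))%N by lia.
apply: (is_dsec_sign hM (inter_open oU s)).
apply: (is_dsec_db_prod hM (inter_open oU s)) => //.
  exact: cochain_dsec cx (@inter_take _ _ _ U _ _) (size_take_face sn cn) c1.
exact: cochain_dsec cy (@inter_drop _ _ _ U _ _) (size_drop_face sn cn) c2.
Qed.

Lemma cochain_eq_cup r1 p r2 q x x' y y' : (0 < q)%N ->
  @cochain_eq _ _ _ U r1 p x x' -> @cochain_eq _ _ _ U r2 q y y' ->
  @cochain_eq _ _ _ U (r1 + r2) (p + q) (@cup R M I r1 p r2 q x y)
    (@cup R M I r1 p r2 q x' y').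
Proof.
move=> q0 xx yy s /andP[+ _]; case sn : (size s) => [//|n] _.
rewrite !(cupE _ _ _ _ _ _ sn) subSS; apply: dsec_eq_sum => c _.
have cn := ltn_ord c.
case: (boolP (_ && _)) => [/andP[c1 c2]|_]; last exact: dsec_eq_refl.
have -> : (r1 + r2 - n)%N = (r1 - c + (r2 - (n - c)))%N by lia.
apply: dsec_eq_sign; apply: (dsec_eq_db_prod hM (inter_open oU s)) => //.
  exact: cochain_dsec_eq xx (@inter_take _ _ _ U _ _) (size_take_face sn cn) c1.
exact: cochain_dsec_eq yy (@inter_drop _ _ _ U _ _) (size_drop_face sn cn) c2.
Qed.

Lemma cup0l r1 p r2 q y : @cup R M I r1 p r2 q 0 y = 0 :> (seq I -> dsec M).
Proof.
apply/funext => s; rewrite /cup big1 // => c _.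
by rewrite db_prod0l mul0rz if_same.
Qed.

Lemma cup0r r1 p r2 q x : (0 < q)%N ->
  @cup R M I r1 p r2 q x 0 = 0 :> (seq I -> dsec M).
Proof.
move=> q0; apply/funext => s; rewrite /cup big1 // => c _.
by rewrite db_prod0r // mul0rz if_same.
Qed.

Lemma cupA r1 p1 r2 p2 r3 p3 x y z : (0 < p2)%N -> (0 < p3)%N ->
  @is_cochain _ _ _ U r2 p2 y -> @is_cochain _ _ _ U r3 p3 z ->
  @cochain_eq _ _ _ U (r1 + r2 + r3) (p1 + p2 + p3)
    (@cup R M I (r1 + r2) (p1 + p2) r3 p3 (@cup R M I r1 p1 r2 p2 x y) z)
    (@cup R M I r1 p1 (r2 + r3) (p2 + p3) x (@cup R M I r2 p2 r3 p3 y z)).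
Proof.
move=> p20 p30 cy cz s /andP[+ _]; case sn : (size s) => [//|n] _.
have p230 : (0 < p2 + p3)%N by rewrite addn_gt0 p20.
rewrite !(cupE _ _ _ _ _ _ sn) subSS.
(* The contribution of cutting the simplex at vertices a <= b into pieces for x, y and z; both
   bracketings are sums of these terms. *)
pose L a b : dsec M := if [&& (a <= r1)%N, (b - a <= r2)%N & (n - b <= r3)%N] then
  db_prod (p1 + p2) p3 (r1 + r2 - b) (r3 - (n - b))
    (db_prod p1 p2 (r1 - a) (r2 - (b - a)) (x (take a.+1 s))
       (y (drop a (take b.+1 s)))) (z (drop b s))
    *~ (-1) ^+ (a * (r2 - (b - a)) + b * (r3 - (n - b))) else 0.
rewrite [X in dsec_eq _ _ _ X](_ : _ = \sum_(b < n.+1) \sum_(a < b.+1) L a b);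
    last first.
  apply: eq_bigr => b _; have bn := ltn_ord b.
  rewrite (cupE _ _ _ _ _ _ (size_take_face sn bn)).
  (* From a <= r1 and b - a <= r2 follows b <= r1 + r2, so when the outer guard fails every inner
     guard does. *)
  case: ifP => [/andP[b12 b3]|nb]; last first.
    rewrite big1 // => a _; have ab := ltn_ord a; rewrite /L ifF //.
    by apply/negP => /and3P[h1 h2 h3]; move/negP: nb; apply; apply/andP; split; lia.
  rewrite db_prod_suml mulrz_suml; apply: eq_bigr => a _; have ab := ltn_ord a.
  rewrite /L b3 andbT; case: ifP => _; last by rewrite db_prod0l mul0rz.
  by rewrite db_prod_signl mulrz_signD take_takel.
rewrite triangle_sum; apply: dsec_eq_sum => a _; have an := ltn_ord a.
have sd := size_drop_face sn an; have std := size_take_face sn an.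
case: ifP => [/andP[a1 a23]|na]; last first.
  rewrite big1; first exact: dsec_eq_refl.
  move=> m _; have mn := ltn_ord m; rewrite /L ifF //.
  by apply/negP => /and3P[h1 h2 h3]; move/negP: na; apply; apply/andP; split; lia.
have oV := inter_open oU s.
have dy m : (m < (n - a).+1)%N -> (m <= r2)%N ->
    is_dsec p2 (r2 - m) (inter U s) (y (take m.+1 (drop a s))).
  move=> mn m2; apply: (cochain_dsec cy _ (size_take_face sd mn) m2).
  by apply: subset_trans (@inter_drop _ _ _ U a s) _; exact: inter_take.
have dz m : (m < (n - a).+1)%N -> (n - a - m <= r3)%N ->
    is_dsec p3 (r3 - (n - a - m)) (inter U s) (z (drop m (drop a s))).
  move=> mn m3; apply: (cochain_dsec cz _ (size_drop_face sd mn) m3).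
  by apply: subset_trans (@inter_drop _ _ _ U a s) _; exact: inter_drop.
rewrite (cupE _ _ _ _ _ _ sd).
have eT : (r1 + r2 + r3 - n)%N = (r1 - a + (r2 + r3 - (n - a)))%N by lia.
have split_sum := @db_prod_sumr _ _ hM _ oV p1 (p2 + p3) (r1 - a)
  (r2 + r3 - (n - a)) (x (take a.+1 s)).
apply: dsec_eq_sym; rewrite eT -(addnA p1).
apply: dsec_eq_trans (dsec_eq_sign _ (split_sum _ _ _ _ p230 _)) _.
  move=> m _; have mn := ltn_ord m.
  case: ifP => [/andP[m2 m3]|_]; last exact: (is_dsec0 hM oV).
  have -> : (r2 + r3 - (n - a) = r2 - m + (r3 - (n - a - m)))%N by lia.
  apply: (is_dsec_sign hM oV); apply: (is_dsec_db_prod hM oV) => //.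
    exact: dy.
  exact: dz.
rewrite mulrz_suml; apply: dsec_eq_sum => m _; have mn := ltn_ord m.
rewrite /L a1 addKn subnDA /=.
case: ifP => [/andP[m2 m3]|_]; last first.
  by rewrite db_prod0r // mul0rz; exact: dsec_eq_refl.
have e23 : (r2 + r3 - (n - a) = r2 - m + (r3 - (n - a - m)))%N by lia.
have e12 : (r1 + r2 - (a + m) = r1 - a + (r2 - m))%N by lia.
have dym := dy m mn m2; have dzm := dz m mn m3.
have dyz := is_dsec_db_prod hM oV p30 dym dzm.
rewrite e23 e12; set S := (_ *~ _ in X in dsec_eq _ _ _ _ X).
apply: dsec_eq_trans (dsec_eq_sign _ (db_prod_signr hM oV _ _ _ _ p230 dyz)) _.
rewrite mulrz_signD {}/S take_drop drop_drop.
have -> : (m.+1 + a = (a + m).+1)%N by rewrite addSn addnC.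
rewrite (addnC m a) !addnA.
(* With b = a + m the Koszul exponents of the two bracketings agree as natural numbers, not merely
   in parity. *)
rewrite [X in _ *~ (-1) ^+ X](_ : _ =
  a * (r2 - m) + (a + m) * (r3 - (n - a - m)))%N; last by rewrite mulnDl mulnDr; lia.
apply: dsec_eq_sign; apply: dsec_eq_sym.
move: dym dzm; rewrite take_drop drop_drop addSn (addnC m a) => dym dzm.
exact: (db_prodA hM oV _ _ _ p20 p30 dym dzm).
Qed.

End Cup.

(** * The differential is a graded derivation for the cup product *)

Section Differential.
Context {R : realType} {M : charted R} (hM : smooth_manifold M).

Lemma is_form_int (U : set M) (n : M -> int) : open U -> locally_constant U n ->
  is_form 0 U (int_form n : rform M R).
Proof.
move=> oU nU; split=> //.
- move=> a vs _; apply: smooth_on_near_cst; first exact: creg_open.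
  move=> z az; rewrite /int_form.
  by apply: filterS (locally_constant_chart hM nU az) => y ->.
- by move=> a b z vs az _; rewrite /int_form (cinv_ctrans hM az).
Qed.

Lemma is_dsec_ddel (U : set M) p e (s : dsec M) : open U -> is_dsec p e U s ->
  is_dsec p e.+1 U (ddel p e s).
Proof.
move=> oU ds; case: (leqP p e) => [pe|ep].
  by rewrite ddel_big //; exact: is_dsec0.
rewrite /is_dsec /= => _; case: (eqVneq e 0%N) ds => [->|e0] ds.
  by rewrite ddel_int ?(leq_trans _ ep) //; exact: is_form_int.
rewrite ddel_form //= -(prednK (n := e)) ?lt0n //.
by apply: is_form_dR => //; exact: is_dsec_form ds e0 (ltnW ep).
Qed.

Context {I : Type} (U : I -> set M) (oU : forall a, open (U a)).
Implicit Types (s t : seq I) (x y : seq I -> dsec M) (r p q : nat).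

Lemma cech_dsec r p x s t c : @is_cochain _ _ _ U r p x ->
  inter U s `<=` inter U t -> size t = c.+2 -> (c <= r)%N ->
  is_dsec p (r - c) (inter U s) (@cech_delta R M I r p x t).
Proof.
move=> cx st tc cr; apply: (is_dsec_sum hM (inter_open oU s)) => l _.
apply: (is_dsec_sign hM (inter_open oU s)); apply: cochain_dsec cx _ _ cr.
  by apply: subset_trans st _; exact: inter_del.
by apply: (size_del tc); rewrite -tc; exact: ltn_ord.
Qed.

Section Summands.
Context (r1 p r2 q : nat) (x y : seq I -> dsec M) (s : seq I) (n : nat).
Hypothesis sn : size s = n.+1.
Local Notation xs c := (x (take c.+1 s)).
Local Notation ys c := (y (drop c s)).

(** [dleft], [dright], [cechleft] and [cechright] are the four kinds of terms at the cut c: d or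
    delta applied to x or to y, with all signs gathered in one exponent. Both sides of the Leibniz
    rule are reduced to sums of them. *)
Definition dleft (c : nat) : dsec M :=
  if (c <= r1)%N && (n - c <= r2)%N then
    db_prod p q (r1 - c).+1 (r2 - (n - c)) (ddel p (r1 - c) (xs c)) (ys c)
      *~ (-1) ^+ (c * (r2 - (n - c)))
  else 0.

Definition dright (c : nat) : dsec M :=
  if (c <= r1)%N && (n - c <= r2)%N then
    db_prod p q (r1 - c) (r2 - (n - c)).+1 (xs c) (ddel q (r2 - (n - c)) (ys c))
      *~ (-1) ^+ (c * (r2 - (n - c)).+1 + r1)
  else 0.

(** The front face at cut c = c' + 1 has dimension c and its faces have dimension c', where x has
    Deligne degree r1 - c'. At c = 0 the front is a vertex, on which D has no Cech part. *)
Definition cechleft (c : nat) : dsec M :=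
  if c is c'.+1 then
    if (c' <= r1)%N && (n - c <= r2)%N then
      \sum_(l < c.+1)
        db_prod p q (r1 - c') (r2 - (n - c)) (x (del l (take c.+1 s))) (ys c)
          *~ (-1) ^+ (l + (r1 - c') + c * (r2 - (n - c)))
    else 0
  else 0.

Definition cechright (c : nat) : dsec M :=
  if (n - c)%N is m.+1 then
    if (c <= r1)%N && (m <= r2)%N then
      \sum_(l < m.+2)
        db_prod p q (r1 - c) (r2 - m) (xs c) (y (del l (drop c s)))
          *~ (-1) ^+ (l + (r2 - m) + c * (r2 - m) + r1)
    else 0
  else 0.

Lemma cup_D_left c : (c < n.+1)%N ->
  (if (c <= r1.+1)%N && (n - c <= r2)%N then
     db_prod p q (r1.+1 - c) (r2 - (n - c)) (@D R M I r1 p x (take c.+1 s)) (ys c)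
       *~ (-1) ^+ (c * (r2 - (n - c)))
   else 0) = dleft c + cechleft c.
Proof.
move=> cn; rewrite /dleft /cechleft.
have [c2|c2] := boolP (n - c <= r2)%N; last first.
  by rewrite !andbF add0r; case: c {cn c2} => // c; rewrite andbF.
rewrite !andbT; case: (leqP c r1.+1) => [cr|rc]; last first.
  have -> : (c <= r1)%N = false by lia.
  rewrite add0r; case: c cn c2 rc => // c _ _ rc.
  by have -> : (c <= r1)%N = false by lia.
rewrite (@DE _ _ _ _ _ _ _ _ _ (size_take_face sn cn) cr erefl).
rewrite db_prodDl mulrzDl; congr (_ + _).
  case: (leqP c r1) => [c1|c1]; first by rewrite subSn.
  have -> : (r1.+1 - c = 0)%N by lia.
  by rewrite db_prod0l mul0rz.
case: c cn c2 cr => [|c] cn c2 cr; first by rewrite db_prod0l mul0rz.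
rewrite andbT -ltnS cr /= subSS db_prod_signl db_prod_suml !mulrz_suml.
rewrite (size_take_face sn cn); apply: eq_bigr => l _.
by rewrite db_prod_signl !mulrz_signD !addnA.
Qed.

Hypothesis q0 : (0 < q)%N.
Hypotheses (cx : @is_cochain _ _ _ U r1 p x) (cy : @is_cochain _ _ _ U r2 q y).
Local Notation V := (inter U s).
Let oV : open V := inter_open oU s.

(** Only a [dsec_eq], unlike [cup_D_left]: D y is a sum in the right factor, and splitting the
    product over it requires each summand to be a section. *)
Lemma cup_D_right c : (c < n.+1)%N ->
  dsec_eq (p + q) ((r1 + r2).+1 - n) V
  ((if (c <= r1)%N && (n - c <= r2.+1)%N then
     db_prod p q (r1 - c) (r2.+1 - (n - c)) (xs c) (@D R M I r2 q y (drop c s))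
       *~ (-1) ^+ (c * (r2.+1 - (n - c)))
   else 0) *~ (-1) ^+ r1) (dright c + cechright c).
Proof.
move=> cn; rewrite /dright /cechright.
have [c1|c1] := boolP (c <= r1)%N; last first.
  rewrite mul0rz add0r; case: (n - c)%N => [|m]; exact: dsec_eq_refl.
case: (leqP (n - c) r2.+1) => [cr|rc] /=; last first.
  have -> : (n - c <= r2)%N = false by lia.
  rewrite add0r mul0rz; case: (n - c)%N rc => // m rc.
  have -> : (m <= r2)%N = false by lia.
  exact: dsec_eq_refl.
have sd := size_drop_face sn cn.
have -> : ((r1 + r2).+1 - n = r1 - c + (r2.+1 - (n - c)))%N by lia.
rewrite (@DE _ _ _ _ _ _ _ _ _ sd cr erefl).
have sV := @inter_drop _ _ _ U c s.
have d1 : is_dsec q (r2.+1 - (n - c)) V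
    (if (r2.+1 - (n - c))%N is e.+1 then ddel q e (ys c) else 0).
  case e : (r2.+1 - (n - c))%N => [|e']; first exact: (is_dsec0 hM oV).
  have er : e' = (r2 - (n - c))%N by lia.
  have cr' : (n - c <= r2)%N by lia.
  by rewrite er; apply: is_dsec_ddel => //; exact: cochain_dsec cy sV sd cr'.
have dl m (l : 'I_m.+2) : (n - c)%N = m.+1 -> (m <= r2)%N ->
    is_dsec q (r2 - m) V (y (del l (drop c s))).
  move=> em mr; apply: cochain_dsec cy _ _ mr.
    by apply: subset_trans sV _; exact: inter_del.
  by rewrite em in sd; exact: size_del sd (ltn_ord l).
have d2 : is_dsec q (r2.+1 - (n - c)) V (if (n - c)%N is 0 then 0 else
    @cech_delta R M I r2 q y (drop c s) *~ (-1) ^+ (r2.+1 - (n - c))).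
  case em : (n - c)%N cr sd => [|m] cr sd; first exact: (is_dsec0 hM oV).
  apply: (is_dsec_sign hM oV); rewrite subSS; exact: cech_dsec cy sV sd cr.
rewrite mulrz_signD.
apply: dsec_eq_trans (dsec_eq_sign _ (db_prodDr oV p _ _ q0 d1 d2)) _.
rewrite mulrzDl; apply: dsec_eqD.
  apply: dsec_eq_of_eq; case: (leqP (n - c) r2) => [c2|c2].
    by rewrite subSn.
  have -> : (r2.+1 - (n - c) = 0)%N by lia.
  by rewrite db_prod0r // mul0rz.
move: d2; case em : (n - c)%N cr sd => [|m] cr sd d2.
  by rewrite db_prod0r // mul0rz; exact: dsec_eq_refl.
rewrite -ltnS cr /= subSS.
have dcd := cech_dsec cy sV sd cr.
apply: dsec_eq_trans (dsec_eq_sign _ (db_prod_signr hM oV _ _ _ _ q0 dcd)) _.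
rewrite mulrz_signD.
apply: dsec_eq_trans (dsec_eq_sign _ (db_prod_sumr hM oV p _ _ _ q0 _)) _.
  move=> l _; apply: (is_dsec_sign hM oV); rewrite sd in l *; exact: dl.
rewrite sd mulrz_suml; apply: dsec_eq_sum => l _.
apply: dsec_eq_trans (dsec_eq_sign _ (db_prod_signr hM oV _ _ _ _ q0 _)) _.
  exact: dl.
by rewrite mulrz_signD !addnA; exact: dsec_eq_refl.
Qed.

Lemma cup_ddel c : (0 < p)%N -> (c < n.+1)%N -> (n <= r1 + r2)%N ->
  dsec_eq (p + q) ((r1 + r2).+1 - n) V
    (ddel (p + q) (r1 + r2 - n)
      (if (c <= r1)%N && (n - c <= r2)%N then
        db_prod p q (r1 - c) (r2 - (n - c)) (xs c) (ys c)
          *~ (-1) ^+ (c * (r2 - (n - c)))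
       else 0)) (dleft c + dright c).
Proof.
move=> p0 cn nr; rewrite /dleft /dright.
case: (boolP (_ && _)) => [/andP[c1 c2]|_]; last first.
  by rewrite ddel0 addr0; exact: dsec_eq_refl.
have dx := cochain_dsec cx (@inter_take _ _ _ U _ s) (size_take_face sn cn) c1.
have dy := cochain_dsec cy (@inter_drop _ _ _ U _ s) (size_drop_face sn cn) c2.
rewrite subSn //.
have -> : (r1 + r2 - n = r1 - c + (r2 - (n - c)))%N by lia.
have dxy := is_dsec_db_prod hM oV q0 dx dy.
apply: dsec_eq_trans (ddel_sign oV _ dxy) _.
apply: dsec_eq_trans (dsec_eq_sign _ (ddel_db_prod hM oV p0 q0 dx dy)) _.
apply: dsec_eq_of_eq; rewrite mulrzDl mulrz_signD; congr (_ + _).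
apply: mulrz_parity.
(* The local Leibniz sign (-1)^(r1 - c) and the global sign (-1)^r1 differ by c, as do the two
   Koszul exponents; in total an even 2c. *)
have -> : (c * (r2 - (n - c)).+1 + r1 =
    r1 - c + c * (r2 - (n - c)) + c.*2)%N by rewrite mulnS; lia.
by rewrite [RHS]oddD odd_double addbF.
Qed.

(** At each cut c of a face, [faces_split] separates deletions in front from deletions behind. The
    former restore a front with one more vertex and land at cut c + 1, the latter at cut c; the end
    terms [cechleft] at 0 and [cechright] at n are 0. *)
Lemma cup_cech : (n <= (r1 + r2).+1)%N ->
  (if n is 0 then 0 else @cech_delta R M I (r1 + r2) (p + q)
      (@cup R M I r1 p r2 q x y) s *~ (-1) ^+ ((r1 + r2).+1 - n)) =
  \sum_(c < n.+1) (cechleft c + cechright c).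
Proof.
move=> nr; case en : n => [|n'].
  by rewrite big_ord1 /cechleft /cechright en addr0.
rewrite big_split big_ord_recl [X in _ = _ + X]big_ord_recr /=.
have -> : cechright n'.+1 = 0 by rewrite /cechright en subnn.
rewrite add0r addr0 -big_split /=.
have sn' : size s = n'.+2 by rewrite sn en.
rewrite en in nr.
pose b c (t u : seq I) : dsec M := if (c <= r1)%N && (n' - c <= r2)%N then
  db_prod p q (r1 - c) (r2 - (n' - c)) (x t) (y u)
    *~ (-1) ^+ (c * (r2 - (n' - c)))
  else 0.
rewrite /cech_delta mulrz_suml sn'.
transitivity (\sum_(l < n'.+2) \sum_(c < n'.+1)
    b c (take c.+1 (del l s)) (drop c (del l s)) *~ (-1) ^+ l
     *~ (-1) ^+ ((r1 + r2).+1 - n'.+1)).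
  apply: eq_bigr => l _.
  have sdl : size (del l s) = n'.+1 by exact: size_del sn' (ltn_ord l).
  by rewrite (cupE _ _ _ _ _ _ sdl) !mulrz_suml.
rewrite exchange_big /=; apply: eq_bigr => c _; have cn := ltn_ord c.
rewrite -mulrz_suml (faces_split (b c) sn') //.
have -> : bump 0 c = c.+1 by [].
have ec : (n'.+1 - c)%N = (n' - c).+1 by rewrite subSn.
rewrite mulrzDl !mulrz_suml /b /cechleft /cechright en ec.
rewrite !subSS; case: (boolP (_ && _)) => [/andP[c1 c2]|nc]; last first.
  by rewrite !big1 // => l _; rewrite !mul0rz.
(* The Deligne degree of the product is the sum of those of its factors. In the sign of D, the share
   of y raises the Koszul coefficient from c to c + 1 on the left; the share r1 - c of x combines
   with the shift c of [faces_split] into r1 on the right. *)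
congr (_ + _); apply: eq_bigr => l _; rewrite !mulrz_signD.
  by congr (_ *~ (-1) ^+ _); rewrite mulSn; lia.
by congr (_ *~ (-1) ^+ _); lia.
Qed.

End Summands.

Lemma D_cup r1 p r2 q x y : (0 < p)%N -> (0 < q)%N ->
  @is_cochain _ _ _ U r1 p x -> @is_cochain _ _ _ U r2 q y ->
  @cochain_eq _ _ _ U (r1 + r2).+1 (p + q)
    (@D R M I (r1 + r2) (p + q) (@cup R M I r1 p r2 q x y))
    ((@cup R M I r1.+1 p r2 q (@D R M I r1 p x) y : seq I -> dsec M) +
     (@cup R M I r1 p r2.+1 q x (@D R M I r2 q y) : seq I -> dsec M)
       *~ (-1) ^+ r1).
Proof.
move=> p0 q0 cx cy s /[dup] s0 /andP[+ _]; case sn : (size s) => [//|n] _.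
have nr := size_face s0 sn.
rewrite (@DE _ _ _ _ _ _ _ _ _ sn nr erefl) (cup_cech p x y sn q0 nr).
rewrite -[X in dsec_eq _ _ _ _ X]/(@cup R M I r1.+1 p r2 q (@D R M I r1 p x) y s +
  ((@cup R M I r1 p r2.+1 q x (@D R M I r2 q y) : seq I -> dsec M)
       *~ (-1) ^+ r1) s).
rewrite cochain_signE !(cupE _ _ _ _ _ _ sn) subSS.
rewrite mulrz_suml -[X in dsec_eq _ _ _ _ X]big_split.
have dd : dsec_eq (p + q) ((r1 + r2).+1 - n) (inter U s)
    (if ((r1 + r2).+1 - n)%N is e.+1 then
       ddel (p + q) e (\sum_(c < n.+1)
          if (c <= r1)%N && (n - c <= r2)%N then
           db_prod p q (r1 - c) (r2 - (n - c)) (x (take c.+1 s)) (y (drop c s))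
              *~ (-1) ^+ (c * (r2 - (n - c)))
          else 0)
     else 0)
    (\sum_(c < n.+1) (dleft r1 p r2 q x y s n c + dright r1 p r2 q x y s n c)).
  (* For n = r1 + r2 + 1 the target has Deligne degree 0 and receives no d; no cut has c <= r1 and n
     - c <= r2, so the right side is empty too. *)
  case: (leqP n (r1 + r2)) => [nr12|nr12]; last first.
    have -> : ((r1 + r2).+1 - n = 0)%N by lia.
    rewrite big1; first exact: dsec_eq_refl.
    move=> c _; have cn := ltn_ord c.
    have nc : (c <= r1)%N && (n - c <= r2)%N = false by lia.
    by rewrite /dleft /dright nc addr0.
  rewrite subSn //.
  apply: dsec_eq_trans (ddel_sum hM (inter_open oU s) _ _) _.
    move=> c _; have := is_cochain_cup hM oU q0 cx cy.
    have cn := ltn_ord c.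
    case: (boolP (_ && _)) => [/andP[c1 c2]|_] _; last first.
      exact: (is_dsec0 hM (inter_open oU s)).
    have -> : (r1 + r2 - n = r1 - c + (r2 - (n - c)))%N by lia.
    apply: (is_dsec_sign hM (inter_open oU s)).
    apply: (is_dsec_db_prod hM (inter_open oU s)) => //.
      exact: cochain_dsec cx (@inter_take _ _ _ U _ _) (size_take_face sn cn) c1.
    exact: cochain_dsec cy (@inter_drop _ _ _ U _ _) (size_drop_face sn cn) c2.
  apply: dsec_eq_sum => c _.
  by rewrite -subSn //; apply: (cup_ddel sn).
apply: dsec_eq_trans (dsec_eqD dd (dsec_eq_refl _ _ _ _)) _.
rewrite -big_split; apply: dsec_eq_sum => c _ /=; have cn := ltn_ord c.
have eL := @cup_D_left r1 p r2 q x y s n sn c cn.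
have eR := @cup_D_right r1 p r2 q x y s n sn q0 cy c cn.
apply: dsec_eq_trans (dsec_eqD (dsec_eq_of_eq _ _ _ (esym eL)) (dsec_eq_sym eR)).
by apply: dsec_eq_of_eq; exact: addrACA.
Qed.

End Differential.

(** * Massey products *)

Lemma mulrz_signS_cancel {V : zmodType} (x : V) n :
  x *~ (-1) ^+ n.+1 + x *~ (-1) ^+ n = 0.
Proof. by rewrite exprS mulN1r mulrNz addNr. Qed.

Section Massey.
Context {R : realType} {M : charted R} (hM : smooth_manifold M).
Context {I : Type} (U : I -> set M) (oU : forall a, open (U a)).
Implicit Types (s t : seq I) (x y z a b : seq I -> dsec M) (r p q : nat).

Lemma cochain_eq_of_eq r p x y : x = y -> @cochain_eq _ _ _ U r p x y.
Proof. by move=> ->; exact: cochain_eq_refl. Qed.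

(** Written with successors so that the predecessors in the degrees compute: (i.+1 + j.+1).-1 is
    convertible to i + j.+1. The version [massey_cocycle_pos] then follows by conversion. *)
Lemma massey_cocycle i j k x y z a b :
  @cocycle _ _ _ U i.+1 i.+1 x -> @is_cochain _ _ _ U j.+1 j.+1 y ->
  @cocycle _ _ _ U k.+1 k.+1 z ->
  @is_cochain _ _ _ U (i + j.+1) (i.+1 + j.+1) a ->
  @is_cochain _ _ _ U (j + k.+1) (j.+1 + k.+1) b ->
  @cochain_eq _ _ _ U (i.+1 + j.+1) (i.+1 + j.+1)
    (@cup R M I i.+1 i.+1 j.+1 j.+1 x y) (@D R M I (i + j.+1) (i.+1 + j.+1) a) ->
  @cochain_eq _ _ _ U (j.+1 + k.+1) (j.+1 + k.+1)
    (@cup R M I j.+1 j.+1 k.+1 k.+1 y z) (@D R M I (j + k.+1) (j.+1 + k.+1) b) ->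
  @cocycle _ _ _ U (i + j.+1 + k.+1) (i.+1 + j.+1 + k.+1)
    ((@cup R M I i.+1 i.+1 (j + k.+1) (j.+1 + k.+1) x b : seq I -> dsec M) +
     (@cup R M I (i + j.+1) (i.+1 + j.+1) k.+1 k.+1 a z : seq I -> dsec M)
        *~ (-1) ^+ i).
Proof.
move=> [cx Dx] cy [cz Dz] ca cb Da Db.
(* The underlying type of [cochain] ignores its degrees, so reassociating them is a rewriting of
   indices in the predicates, without any transport of cochains. *)
have er : (i.+1 + (j + k.+1) = i + j.+1 + k.+1)%N by lia.
have ep : (i.+1 + (j.+1 + k.+1) = i.+1 + j.+1 + k.+1)%N by lia.
have q0 : (0 < j.+1 + k.+1)%N by [].
have cxb := is_cochain_cup hM oU q0 cx cb; rewrite er ep in cxb.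
have caz := is_cochain_cup hM oU (ltn0Sn k) ca cz.
have caz' := is_cochain_sign hM oU i caz.
split; first exact: is_cochainD.
apply: cochain_eq_trans (D_add oU cxb caz') _.
pose xyz := @cup R M I i.+1 i.+1 (j.+1 + k.+1) (j.+1 + k.+1) x
  (@cup R M I j.+1 j.+1 k.+1 k.+1 y z) : seq I -> dsec M.
have Dxb : @cochain_eq _ _ _ U (i + j.+1 + k.+1).+1 (i.+1 + j.+1 + k.+1)
    (@D R M I (i + j.+1 + k.+1) (i.+1 + j.+1 + k.+1)
       (@cup R M I i.+1 i.+1 (j + k.+1) (j.+1 + k.+1) x b))
    (xyz *~ (-1) ^+ i.+1).
  have h := D_cup hM oU (ltn0Sn i) q0 cx cb; rewrite er ep in h.
  (* As x is a cocycle, D x u b vanishes; only x u D b remains, with the sign (-1)^(i+1) coming from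
     the degree i + 1 of x. *)
  have h1 := cochain_eq_cup hM oU q0 Dx
    (@cochain_eq_refl _ _ _ U (j + k.+1) (j.+1 + k.+1) b).
  have h2 := cochain_eq_cup hM oU q0 (@cochain_eq_refl _ _ _ U i.+1 i.+1 x)
    (cochain_eq_sym Db).
  rewrite cup0l addSn er ep in h1; rewrite ep in h2.
  apply: cochain_eq_trans h _.
  rewrite -[X in @cochain_eq _ _ _ _ _ _ _ X](add0r (xyz *~ _)).
  exact: cochain_eqD h1 (cochain_eq_sign _ h2).
have Daz : @cochain_eq _ _ _ U (i + j.+1 + k.+1).+1 (i.+1 + j.+1 + k.+1)
    (@D R M I (i + j.+1 + k.+1) (i.+1 + j.+1 + k.+1)
       (@cup R M I (i + j.+1) (i.+1 + j.+1) k.+1 k.+1 a z)) xyz.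
  have h := D_cup hM oU (ltn0Sn _) (ltn0Sn k) ca cz.
  have h1 := cochain_eq_cup hM oU (ltn0Sn k)
    (@cochain_eq_refl _ _ _ U (i + j.+1) (i.+1 + j.+1) a) Dz.
  have h2 := cochain_eq_cup hM oU (ltn0Sn k) (cochain_eq_sym Da)
    (@cochain_eq_refl _ _ _ U k.+1 k.+1 z).
  (* Associativity brings (x u y) u z to the same cochain [xyz] that appears in D (x u b), so that
     the two can cancel. *)
  have h3 := @cupA _ _ hM _ U oU i.+1 i.+1 _ _ _ _ x _ _ (ltn0Sn j) (ltn0Sn k) cy cz.
  have e0 := @cup0r R M I (i + j.+1) (i.+1 + j.+1) k.+2 k.+1 a (ltn0Sn k).
  have h0 := cochain_eq_trans h1 (@cochain_eq_of_eq _ _ _ _ e0).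
  rewrite addnS in h0.
  apply: cochain_eq_trans h _.
  rewrite -[X in @cochain_eq _ _ _ _ _ _ _ X](addr0 xyz).
  rewrite -[X in @cochain_eq _ _ _ _ _ _ _ (xyz + X)](mul0rz _ ((-1) ^+ (i + j.+1))).
  exact: cochain_eqD (cochain_eq_trans h2 h3) (cochain_eq_sign _ h0).
have Daz' := cochain_eq_trans (D_sign oU i caz) (cochain_eq_sign i Daz).
apply: cochain_eq_trans (cochain_eqD Dxb Daz') _.
exact: cochain_eq_of_eq (mulrz_signS_cancel xyz i).
Qed.

Lemma massey_cocycle_pos i j k x y z a b :
  (0 < i)%N -> (0 < j)%N -> (0 < k)%N ->
  @cocycle _ _ _ U i i x -> @is_cochain _ _ _ U j j y ->
  @cocycle _ _ _ U k k z ->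
  @is_cochain _ _ _ U (i + j).-1 (i + j) a ->
  @is_cochain _ _ _ U (j + k).-1 (j + k) b ->
  @cochain_eq _ _ _ U (i + j) (i + j)
    (@cup R M I i i j j x y) (@D R M I (i + j).-1 (i + j) a) ->
  @cochain_eq _ _ _ U (j + k) (j + k)
    (@cup R M I j j k k y z) (@D R M I (j + k).-1 (j + k) b) ->
  @cocycle _ _ _ U (i + j + k).-1 (i + j + k)
    ((@cup R M I i i (j + k).-1 (j + k) x b : seq I -> dsec M) +
     (@cup R M I (i + j).-1 (i + j) k k a z : seq I -> dsec M) *~ (-1) ^+ i.-1).
Proof.
move=> i0 j0 k0.
case: i i0 => [F|i _]; first by discriminate F.
case: j j0 => [F|j _]; first by discriminate F.
case: k k0 => [F|k _]; first by discriminate F.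
exact (@massey_cocycle i j k x y z a b).
Qed.

Lemma dsec_eq_trunc (V : set M) p p' e (u v : dsec M) : (p' <= p)%N ->
  dsec_eq p e V u v -> dsec_eq p' e V u v.
Proof.
rewrite /dsec_eq; case: ifP => // _ pp h ep; apply: h; exact: leq_trans pp.
Qed.

Lemma is_cochain_trunc r p p' x : (p' <= p)%N ->
  @is_cochain _ _ _ U r p x -> @is_cochain _ _ _ U r p' x.
Proof.
move=> pp cx s /cx; rewrite /is_dsec; case: ifP => // _ h ep; apply: h.
exact: leq_trans pp.
Qed.

Lemma cochain_eq_trunc r p p' x y : (p' <= p)%N ->
  @cochain_eq _ _ _ U r p x y -> @cochain_eq _ _ _ U r p' x y.
Proof. by move=> pp xy s /xy; exact: dsec_eq_trunc. Qed.

(** The two differentials can differ only in Deligne degrees beyond p', and equality in C(p') does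
    not see these. *)
Lemma D_trunc r p p' x : (p' <= p)%N ->
  @cochain_eq _ _ _ U r.+1 p' (@D R M I r p x) (@D R M I r p' x).
Proof.
move=> pp s /[dup] s0 /andP[+ _]; case sn : (size s) => [//|n] _.
have nr := size_face s0 sn.
rewrite !(@DE _ _ _ _ _ _ _ _ _ sn nr erefl) subSS.
apply: dsec_eqD; last exact: dsec_eq_refl.
case: (r.+1 - n)%N => [|e]; first exact: dsec_eq_refl.
rewrite dsec_eqS => ep.
have -> : ddel p e (x s) = ddel p' e (x s).
  by rewrite /ddel (leqNgt p) (leq_trans ep pp) (leqNgt p') ep.
by move=> ? ? ? _ _.
Qed.

Lemma cocycle_trunc r p p' x : (p' <= p)%N ->
  @cocycle _ _ _ U r p x -> @cocycle _ _ _ U r p' x.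
Proof.
move=> pp [cx Dx]; split; first exact: is_cochain_trunc pp cx.
apply: cochain_eq_trans (cochain_eq_sym (D_trunc x pp)) _.
exact: cochain_eq_trunc pp Dx.
Qed.

Lemma coh_class_trunc r p p' x y : (p' <= p)%N ->
  @coh_class _ _ _ U r p x y -> @coh_class _ _ _ U r p' x y.
Proof.
move=> pp [cy yx]; split; first exact: cocycle_trunc pp cy.
case: r yx {cy} => [|r]; first exact: cochain_eq_trunc.
move=> [w cw yx]; exists w; first exact: is_cochain_trunc pp cw.
exact: cochain_eq_trans (cochain_eq_trunc pp yx) (D_trunc w pp).
Qed.

Lemma trunc_class_coh_class r p p' x : (p' <= p)%N ->
  @cocycle _ _ _ U r p x ->
  @trunc_class _ _ _ U r p p' (@coh_class _ _ _ U r p x) = @coh_class _ _ _ U r p' x.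
Proof.
move=> pp cx; apply/seteqP; split=> y.
  move=> [x' xx' x'y].
  exact (coh_class_trans hM oU (coh_class_trunc pp xx') x'y).
by move=> xy; exists x => //; exact: coh_class_refl.
Qed.

End Massey.

Theorem proposition18 (R : realType) (M : manifold R)
    (I : Type) (U : I -> set M) (hU : good_cover U)
    (G : lie_group R) (P : principal_bundle G M) (A : connection P)
    (i j k : nat) (hi : (0 < i)%N) (hj : (0 < j)%N) (hk : (0 < k)%N)
    (ci : char_class G i) (cj : char_class G j) (ck : char_class G k)
    (xi : cochain M I i i) (xj : cochain M I j j) (xk : cochain M I k k)
    (hxi : refines U ci (curvature A) xi)
    (hxj : refines U cj (curvature A) xj)
    (hxk : refines U ck (curvature A) xk)
    (alpha : cochain M I (i + j).-1 (i + j))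
    (beta : cochain M I (j + k).-1 (j + k))
    (halpha : is_cochain U alpha) (hbeta : is_cochain U beta)
    (hD_alpha : cochain_eq U (cup xi xj)
       (D alpha : cochain M I (i + j) (i + j)))
    (hD_beta : cochain_eq U (cup xj xk)
       (D beta : cochain M I (j + k) (j + k))) :
  let mu : cochain M I (i + j + k).-1 (i + j + k) :=
    (cup xi beta : cochain M I (i + j + k).-1 (i + j + k)) +
    (cup alpha xk : cochain M I (i + j + k).-1 (i + j + k))
      *~ (-1) ^+ i.-1 in
  [/\ cocycle U mu,
      diff_cohomology U (i + j + k).-1 (flat_incl U (coh_class U mu)) &
      massey U (coh_class U xi) (coh_class U xj) (coh_class U xk)
        (flat_incl U (coh_class U mu))].
Proof.
have hM := manifoldP M; have oU := gc_open hU.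
case: hxi hxj hxk => [zi _ _] [zj _ _] [zk _ _].
move=> mu; have zmu : cocycle U mu.
  exact (massey_cocycle_pos hM oU hi hj hk zi zj.1 zk halpha hbeta hD_alpha
    hD_beta).
split=> //.
  (* Truncating the weight from i + j + k to one less makes weight and degree agree, so the same
     family [mu] represents a differential cohomology class. *)
  exists (trunc _ mu); first exact (cocycle_trunc (leq_pred _) zmu).
  exact (trunc_class_coh_class hM oU (leq_pred _) zmu).
exists xi, xj, xk, alpha, beta; split=> //.
split.
- exact (coh_class_refl hM oU zi).
- exact (coh_class_refl hM oU zj).
- exact (coh_class_refl hM oU zk).
Qed.
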